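(* Let $n\ge 3$, let $d=\gcd(n,3)$, and let $\mathcal{C}(\boldsymbol{x})=J(\rho(\boldsymbol{x}),\boldsymbol{x})$ be the invariantized Jacobian. Put $$z'_n=\mathcal{C}(\boldsymbol{x})^{-1/d}$$ (real cube root if $d=3$). Then, up to sign, $$z'_n=\left(\delta_{123}^{\,2n-9}\bigl(\Phi^{(1)}_{1,2}\,\Phi^{(1)}_{1,3}\bigr)^{n-3}\prod_{i=4}^{n}\frac{1}{\bigl(\delta_{23i}+\delta_{123}\,\Phi^{(1)}_{1,i}\bigr)^3}\right)^{-1/d},$$ $z'_n$ is a rational function of $(x_i,y_i,p_i,q_i)_{i=1}^n$ and a relative invariant of weight $1/d$, and $z'_n$ is a primitive element (a single generator) of the field of relative invariants over the field of absolute invariants: $$\mathcal{I}_n=\mathcal{I}_{n,0}(z'_n).$$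
   Context: Let $\mathcal{M}=(\mathbb{R}^2\times\mathbb{R}^2)^n$ with coordinates $\boldsymbol{x}=(x_i,y_i,p_i,q_i)_{i=1}^n$, where $(p_i,q_i)$ represents the gradient of a function $u$ at $(x_i,y_i)$. The group $G=PGL(3,\mathbb{R})$ acts partially on $\mathcal{M}$: for $g=[T]$ with $T=\begin{pmatrix} a_1&a_2&a_3\\ b_1&b_2&b_3\\ c_1&c_2&c_3\end{pmatrix}\in GL(3,\mathbb{R})$ put $s_i=c_1x_i+c_2y_i+c_3$; $g\cdot\boldsymbol{x}$ is defined when all $s_i\ne0$, and then $$\widetilde x_i=\frac{a_1x_i+a_2y_i+a_3}{s_i},\qquad \widetilde y_i=\frac{b_1x_i+b_2y_i+b_3}{s_i},$$ while $(\widetilde p_i,\widetilde q_i)$ is given by the standard first prolongation: $p_i=\widetilde p_i\,\partial_x\widetilde x+\widetilde q_i\,\partial_x\widetilde y$, $q_i=\widetilde p_i\,\partial_y\widetilde x+\widetilde q_i\,\partial_y\widetilde y$, with partial derivatives of the projective map evaluated at $(x_i,y_i)$. The same $g$ acts on all blocks. Jacobian multiplier: $J(g,\boldsymbol{x})=\dfrac{(\det T)^n}{\prod_{i=1}^n s_i^3}$ (independent of the representative $T$ of $g$). $\mathcal{I}_{n,0}$ is the field of absolute invariants: all $F\in\mathbb{R}(x_i,y_i,p_i,q_i\mid i=1,\dots,n)$ with $F(g\cdot\boldsymbol{x})=F(\boldsymbol{x})$ for all $g\in G$. A rational function $F\in\mathbb{R}(x_i,y_i,p_i,q_i\mid i=1,\dots,n)$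 is a relative invariant of weight $\omega\in\mathbb{Q}$ if $F(g\cdot\boldsymbol{x})=J(g,\boldsymbol{x})^{\omega}F(\boldsymbol{x})$ for all $g,\boldsymbol{x}$ for which both sides are defined (real powers). $\mathcal{I}_n$ is the subfield of $\mathbb{R}(x_i,y_i,p_i,q_i)$ generated by all relative invariants of all weights $\omega\in\mathbb{Q}$. Moving frame: let $\mathcal{K}\subset\mathcal{M}$ be the cross-section $x_1=1,\ y_1=0,\ x_2=y_2=0,\ x_3=0,\ y_3=1,\ p_1=1,\ q_1=0$. For generic $\boldsymbol{x}\in\mathcal{M}$, $\rho(\boldsymbol{x})\in G$ is the unique element with $\rho(\boldsymbol{x})\cdot\boldsymbol{x}\in\mathcal{K}$; it satisfies $\rho(g\cdot\boldsymbol{x})=\rho(\boldsymbol{x})g^{-1}$. Notation: $\Phi^{(k)}_{i,j}=(x_i-x_j)p_k+(y_i-y_j)q_k$ for $i\neq j$, and $\delta_{ijk}=\begin{vmatrix} x_i&x_j&x_k\\ y_i&y_j&y_k\\ 1&1&1\end{vmatrix}$. *)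

(* Defs.v *)
From HB Require Import structures.
From mathcomp Require Import all_boot all_order all_algebra generic_quotient.
(* mpoly has to come before the analysis files: their notations clash in the
   other order. *)
From mathcomp Require Import mpoly.
From mathcomp Require Import classical_sets boolp functions reals normedtype derive exp.
From mathcomp Require Import ring.

Set Implicit Arguments.
Unset Strict Implicit.
Unset Printing Implicit Defensive.

Import Order.TTheory GRing.Theory Num.Theory.
Import numFieldNormedType.Exports.

Local Open Scope classical_set_scope.
Local Open Scope ring_scope.

Definition GL3 (R : realType) := {T : 'M[R]_3 | T \in unitmx}.

HB.instance Definition _ (R : realType) := Choice.on (GL3 R).

Definition homothetic (R : realType) : rel (GL3 R) :=
  fun S T => `[< exists2 c : R, c != 0 & val S = c *: val T >].

Fact homothetic_refl (R : realType) : reflexive (@homothetic R).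
Proof. by move=> S; apply/asboolP; exists 1; rewrite ?oner_eq0 ?scale1r. Qed.

Fact homothetic_sym (R : realType) : ssrbool.symmetric (@homothetic R).
Proof.
suff sub S T : homothetic S T -> @homothetic R T S.
  by move=> S T; apply/idP/idP; apply: sub.
move=> /asboolP[c c0 eST]; apply/asboolP; exists c^-1; first by rewrite invr_eq0.
by rewrite eST scalerA mulVf ?scale1r.
Qed.

Fact homothetic_trans (R : realType) : transitive (@homothetic R).
Proof.
move=> T S U /asboolP[c c0 eST] /asboolP[c' c'0 eTU]; apply/asboolP.
by exists (c * c'); [rewrite mulf_neq0 | rewrite eST eTU scalerA].
Qed.

Canonical homothetic_equiv (R : realType) :=
  EquivRel (@homothetic R) (@homothetic_refl R) (@homothetic_sym R)
    (@homothetic_trans R).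

Definition PGL3 (R : realType) := {eq_quot (@homothetic R)}%qT.

HB.instance Definition _ (R : realType) := EqQuotient.on (PGL3 R).
HB.instance Definition _ (R : realType) := Choice.on (PGL3 R).

(* The n rows of a configuration are the blocks (x_i, y_i, p_i, q_i). *)
Notation config R n := ('M[R]_(n, 4)).

Definition kx : 'I_4 := @Ordinal 4 0 isT.
Definition ky : 'I_4 := @Ordinal 4 1 isT.
Definition kp : 'I_4 := @Ordinal 4 2 isT.
Definition kq : 'I_4 := @Ordinal 4 3 isT.

Definition fst3 : 'I_3 := @Ordinal 3 0 isT.
Definition snd3 : 'I_3 := @Ordinal 3 1 isT.
Definition thd3 : 'I_3 := @Ordinal 3 2 isT.

Section Action.
Context {R : realType}.
Implicit Types (T : 'M[R]_3) (a b : R).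

Definition linf T (r : 'I_3) a b : R := T r fst3 * a + T r snd3 * b + T r thd3.

Definition projx T a b : R := linf T fst3 a b / linf T thd3 a b.
Definition projy T a b : R := linf T snd3 a b / linf T thd3 a b.

(* The Jacobian matrix of the projective map at (a, b):
   dx xt, dy xt in the first row and dx yt, dy yt in the second one. *)
Definition projD T a b : 'M[R]_2 := \matrix_(i, j)
  match val i, val j with
  | 0, 0 => derive1 (fun t => projx T t b) a
  | 0, _ => derive1 (fun t => projx T a t) b
  | _, 0 => derive1 (fun t => projy T t b) a
  | _, _ => derive1 (fun t => projy T a t) b
  end.

(* The prolongation formulas say (p, q) = (pt, qt) *m projD T a b, which is
   solved for (pt, qt) here: see mxact_prolong. *)
Definition cograd T a b (p q : R) : 'rV[R]_2 :=
  (\row_j [:: p; q]`_j) *m invmx (projD T a b).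

Section Blocks.
Context {n : nat}.
Implicit Types (x : config R n).

Definition sden T x (i : 'I_n) : R := linf T thd3 (x i kx) (x i ky).

Definition mxact T x : config R n := \matrix_(i, k)
  let w := cograd T (x i kx) (x i ky) (x i kp) (x i kq) in
  [:: projx T (x i kx) (x i ky); projy T (x i kx) (x i ky);
      w 0 0; w 0 1]`_k.

Definition mxJ T x : R := \det T ^+ n / \prod_(i < n) sden T x i ^+ 3.

(* The choice of the representative repr g is immaterial: see pact_def_pi,
   pact_pi and jac_pi. *)
Definition pact_def (g : PGL3 R) x := forall i, sden (val (repr g)) x i != 0.
Definition pact (g : PGL3 R) x : config R n := mxact (val (repr g)) x.
Definition jac (g : PGL3 R) x : R := mxJ (val (repr g)) x.

End Blocks.

Lemma linf_scale (c : R) T r a b : linf (c *: T) r a b = c * linf T r a b.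
Proof. by rewrite /linf !mxE; ring. Qed.

Lemma projx_scale (c : R) T : c != 0 -> projx (c *: T) = projx T.
Proof.
move=> c0; apply/funext => a; apply/funext => b.
by rewrite /projx !linf_scale -mulf_div divff ?mul1r.
Qed.

Lemma projy_scale (c : R) T : c != 0 -> projy (c *: T) = projy T.
Proof.
move=> c0; apply/funext => a; apply/funext => b.
by rewrite /projy !linf_scale -mulf_div divff ?mul1r.
Qed.

Lemma repr_pi_scale (T : GL3 R) :
  exists2 c : R, c != 0 & val (repr (\pi_(PGL3 R) T)%qT) = c *: val T.
Proof.
have /eqP : repr (\pi_(PGL3 R) T)%qT = T %[mod PGL3 R]%qT by rewrite reprK.
by rewrite eqmodE => /asboolP.
Qed.

Lemma pact_def_pi n (T : GL3 R) (x : config R n) :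
  pact_def (\pi_(PGL3 R) T)%qT x <-> (forall i, sden (val T) x i != 0).
Proof.
have [c c0 e] := repr_pi_scale T; rewrite /pact_def e.
by split=> h i; move: (h i); rewrite /sden linf_scale mulf_eq0 negb_or c0.
Qed.

Lemma pact_pi n (T : GL3 R) (x : config R n) :
  pact (\pi_(PGL3 R) T)%qT x = mxact (val T) x.
Proof.
have [c c0 e] := repr_pi_scale T; rewrite /pact e.
by apply/matrixP=> i k; rewrite !mxE /cograd /projD projx_scale ?projy_scale.
Qed.

Lemma jac_pi n (T : GL3 R) (x : config R n) :
  jac (\pi_(PGL3 R) T)%qT x = mxJ (val T) x.
Proof.
have [c c0 e] := repr_pi_scale T; rewrite /jac e /mxJ detZ exprMn.
under eq_bigr do rewrite /sden linf_scale exprMn.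
rewrite big_split /= prodr_const card_ord -mulf_div divff ?mul1r //.
by rewrite !expf_neq0.
Qed.

Lemma derive1_frac (al be ga de u : R) : ga * u + de != 0 ->
  derive1 (fun t : R => (al * t + be) / (ga * t + de)) u =
    (al * de - be * ga) / (ga * u + de) ^+ 2.
Proof.
move=> nz.
have d1 (a' b' : R) : is_derive u 1 (fun t : R => a' * t + b') a'.
  have -> : (fun t : R => a' * t + b') =
    ((cst a' : R -> R) * (id : R -> R)) + (cst b' : R -> R) by [].
  by apply: is_derive_eq; rewrite addr0 scaler0 addr0 /GRing.scale /= mulr1.
have d2 : is_derive u 1 (fun t : R => (ga * t + de)^-1)
            (- (ga * u + de) ^- 2 * ga).
  have dd := d1 ga de.
  apply: DeriveDef; first exact: derivableV.
  by rewrite deriveV // derive_val.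
have -> : (fun t : R => (al * t + be) / (ga * t + de)) =
  (fun t : R => al * t + be) * (fun t : R => (ga * t + de)^-1) by [].
have dd1 := d1 al be.
rewrite derive1E derive_val /GRing.scale /=.
by field.
Qed.

Lemma projDE T a b : linf T thd3 a b != 0 ->
  projD T a b = \matrix_(i, j)
    let r : 'I_3 := widen_ord (isT : 2 <= 3)%N i in
    let c : 'I_3 := widen_ord (isT : 2 <= 3)%N j in
    ((T r c * linf T thd3 a b - T thd3 c * linf T r a b)
       / linf T thd3 a b ^+ 2).
Proof.
have row_x (r : 'I_3) : (fun t => linf T r t b / linf T thd3 t b) =
    fun t => (T r fst3 * t + (T r snd3 * b + T r thd3))
             / (T thd3 fst3 * t + (T thd3 snd3 * b + T thd3 thd3)).
  by apply/funext => t; rewrite /linf !addrA.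
have row_y (r : 'I_3) : (fun t => linf T r a t / linf T thd3 a t) =
    fun t => (T r snd3 * t + (T r fst3 * a + T r thd3))
             / (T thd3 snd3 * t + (T thd3 fst3 * a + T thd3 thd3)).
  apply/funext => t; rewrite /linf.
  by congr (_ / _); rewrite addrA [_ * a + _]addrC.
rewrite {1}/linf => nz.
have nzx : T thd3 fst3 * a + (T thd3 snd3 * b + T thd3 thd3) != 0.
  by rewrite addrA.
have nzy : T thd3 snd3 * b + (T thd3 fst3 * a + T thd3 thd3) != 0.
  by rewrite addrCA addrA.
have w1 : widen_ord (isT : 2 <= 3)%N ord0 = fst3 by apply: val_inj.
have w2 : widen_ord (isT : 2 <= 3)%N (lift ord0 ord0) = snd3.
  by apply: val_inj.
apply/matrixP => i j; rewrite !mxE.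
case: (unliftP ord0 i) => [i'|] ->; case: (unliftP ord0 j) => [j'|] ->;
  rewrite ?(ord1 i') ?(ord1 j') ?w1 ?w2 /= /projx /projy ?row_x ?row_y
    derive1_frac // /linf; congr (_ / _ ^+ 2); ring.
Qed.

Lemma det_projD T a b : linf T thd3 a b != 0 ->
  \det (projD T a b) = \det T / linf T thd3 a b ^+ 3.
Proof.
move=> nz.
pose f i j := T (inord i) (inord j).
have fE r c : T r c = f (val r) (val c) by rewrite /f !inord_val.
rewrite projDE // (expand_det_row _ ord0) [in RHS](expand_det_row _ ord0).
rewrite !big_ord_recl !big_ord0 /cofactor !det_mx11.
rewrite !(expand_det_row _ ord0) !big_ord_recl !big_ord0 /cofactor !det_mx11.
rewrite !mxE /linf !fE /= /bump /=.
rewrite /linf !fE /= in nz.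
by field.
Qed.

Lemma mxact_prolong n T (x : config R n) i : T \in unitmx ->
  sden T x i != 0 ->
  let x' := mxact T x in
  let a := x i kx in let b := x i ky in
  x i kp = x' i kp * derive1 (fun t => projx T t b) a
           + x' i kq * derive1 (fun t => projy T t b) a /\
  x i kq = x' i kp * derive1 (fun t => projx T a t) b
           + x' i kq * derive1 (fun t => projy T a t) b.
Proof.
move=> uT nz x' a b.
have uD : projD T a b \in unitmx.
  rewrite unitmxE det_projD // unitfE mulf_neq0 ?invr_eq0 ?expf_neq0 //.
  by rewrite -unitfE -unitmxE.
have one : lift ord0 ord0 = 1 :> 'I_2 by apply: val_inj.
have := mulmxKV uD (\row_j [:: x i kp; x i kq]`_j).
rewrite -/(cograd T a b (x i kp) (x i kq)) /x' !mxE -/a -/b /=.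
move: (cograd _ _ _ _ _) => w /matrixP e.
have := e 0 0; have := e 0 1.
by rewrite !mxE !big_ord_recl !big_ord0 !mxE !addr0 /= one => <- <-.
Qed.

End Action.

(* The variable of block i and coordinate k is 'X_(mxvec_index i k). *)
Notation ratfun R n := {fraction {mpoly R[n * 4]}}.

Section Rational.
Context {R : realType} {n : nat}.
Implicit Types (F : ratfun R n) (x : config R n).

Definition peval (P : {mpoly R[n * 4]}) x : R := P.@[fun k => mxvec x 0 k].

(* F is defined at x, with value v: any fraction representing F whose
   denominator does not vanish at x may be used. *)
Definition feval F x (v : R) := exists P Q : {mpoly R[n * 4]},
  [/\ F = FracField.tofrac P / FracField.tofrac Q, peval Q x != 0
    & v = peval P x / peval Q x].

(* a ^ w as a real number, when rpow_def a w holds: the real root of odd order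
   is taken if a < 0. *)
Definition rpow_def (a : R) (w : rat) :=
  (0 < a) || (a != 0) && odd `|denq w|%N.
Definition rpow (a : R) (w : rat) : R :=
  Num.sg a ^ numq w * powR `|a| (ratr w).

Definition abs_inv : set (ratfun R n) := [set F | forall g x v w,
  pact_def g x -> feval F x v -> feval F (pact g x) w -> w = v].

Definition rel_inv (omega : rat) : set (ratfun R n) :=
  [set F | forall g x v w,
    pact_def g x -> rpow_def (jac g x) omega ->
    feval F x v -> feval F (pact g x) w -> w = rpow (jac g x) omega * v].

Lemma feval_uniq F x v w : feval F x v -> feval F x w -> v = w.
Proof.
move=> [P [Q [-> Q0 ->]]] [P' [Q' [e Q'0 ->]]].
have nz S : peval S x != 0 -> FracField.tofrac S != 0.
  apply: contra_neq => /eqP; rewrite tofrac_eq0 => /eqP ->.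
  by rewrite /peval rmorph0.
move/eqP: e; rewrite eqr_div ?nz // -!rmorphM tofrac_eq => /eqP e.
by apply/eqP; rewrite eqr_div // /peval -!rmorphM e.
Qed.

Definition generically (P : config R n -> Prop) :=
  exists2 Q : {mpoly R[n * 4]}, Q != 0 & forall x, peval Q x != 0 -> P x.

End Rational.

Definition subfield (K : fieldType) (S : set K) :=
  GRing.divring_closed (mem S : {pred K}).

Definition subfield_gen (K : fieldType) (A : set K) : set K :=
  smallest (@subfield K) A.

Definition I_n0 (R : realType) n : set (ratfun R n) := abs_inv.
Definition I_n (R : realType) n : set (ratfun R n) :=
  subfield_gen [set F | exists omega : rat, rel_inv omega F].

Section Frame.
Context {R : realType} {n : nat} (hn : (3 <= n)%N).
Implicit Types (x : config R n) (i j k : 'I_n).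

Definition blk1 : 'I_n := widen_ord hn fst3.
Definition blk2 : 'I_n := widen_ord hn snd3.
Definition blk3 : 'I_n := widen_ord hn thd3.

Definition cross_section : set (config R n) := [set x |
  [/\ x blk1 kx = 1 /\ x blk1 ky = 0, x blk2 kx = 0 /\ x blk2 ky = 0,
      x blk3 kx = 0 /\ x blk3 ky = 1 & x blk1 kp = 1 /\ x blk1 kq = 0]].

Definition frame_at x : set (PGL3 R) :=
  [set g | pact_def g x /\ cross_section (pact g x)].

Definition rho_def x := exists! g, frame_at x g.
(* The default value of xget is irrelevant: rho is used where rho_def holds. *)
Definition rho x : PGL3 R :=
  xget (\pi_(PGL3 R) (exist _ 1%:M (unitmx1 R 3)))%qT (frame_at x).

Definition invJ x : R := jac (rho x) x.

Definition delta x i j k : R :=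
  \det (\matrix_(r < 3, c < 3)
    let l := tnth [tuple i; j; k] c in [:: x l kx; x l ky; 1]`_r).

Definition Phi x k i j : R :=
  (x i kx - x j kx) * x k kp + (x i ky - x j ky) * x k kq.

Definition zprime x : R := rpow (invJ x) (- (gcdn n 3)%:R^-1).

End Frame.

(* Main.v *)
Require Import Defs.
From HB Require Import structures.
From mathcomp Require Import all_boot all_order all_algebra generic_quotient.
From mathcomp Require Import mpoly.
From mathcomp Require Import classical_sets boolp reals topology normedtype derive exp.
From mathcomp Require Import ring zify.

Set Implicit Arguments.
Unset Strict Implicit.
Unset Printing Implicit Defensive.

Import Order.TTheory GRing.Theory Num.Theory.
Import numFieldNormedType.Exports.
Local Open Scope classical_set_scope.
Local Open Scope ring_scope.

(** Write [m = n / d] and [e = 3 / d].  For a matrix [T] representing [g], the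
multiplier is a perfect power, [J(g, x) = Jroot T x ^+ d] with
[Jroot T x = (det T)^m / (prod_i s_i)^e], and [Jroot] is a multiplicative
cocycle that does not involve any root.

Normalization.  Write the action in homogeneous coordinates: it multiplies the
vectors [(x_i, y_i, 1)] by [T] and the covectors [(p_i, q_i, -(p_i x_i + q_i y_i))]
by the inverse of [T], up to the scalars [s_i] (act_related).  The equations of
the cross-section then determine [det T] and all the [s_i] up to the scale of [T]
(frame_sden), so that the frame exists and is unique exactly where the forms
[delta_23i + delta_123 Phi_1i] do not vanish (frame_mxP, frame_unique,
frame_regular), and [Jroot] of the frame is the inverse of an explicit rational
function [zval] (zval_frame).  Because [d] is odd, the real root in the
definition of [z'_n] is [zval] (zprimeE).

Weight of [z'_n].  If [T] is a frame at [x], then [T S^-1] is a frame at [S x];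
the cocycle rule gives [zval (S x) = Jroot S x * zval x] (zval_act).  This is an
identity at points where the frame exists.  A rational identity that holds at
generic points holds wherever both of its sides are defined
(rel_inv_generically), so the fraction [Zfrac] is a relative invariant of weight
[1/d].

Generation.  Let [F] be a nonzero relative invariant of weight [omega].  Restrict
the identity [F(T x) = J^omega F(x)] to a curve of matrices [T = T(t)] with
polynomial entries.  Raised to the power of the denominator of [omega], it becomes
an identity of polynomials in [t], in which multiplicities of roots can be
compared.  Along [diag(t, 1, 1)] one has [J = t^n], along the curve with third
row [(t, 0, 1)] one has [J = prod_i (1 + t x_i)^-3]; hence the denominator of
[omega] divides both [n] and [3] (rel_inv_weight).  Thus [omega = k/d] for an
integer [k], the quotient of [F] by the [k]-th power of [Zfrac] is an absolute
invariant (abs_inv_quotient), and the two fields coincide (I_n_generated). *)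

(** * Polynomials determined by their values *)

Lemma radix_inj (m K : nat) (f g : 'I_m -> nat) :
  (forall i, f i < K)%N -> (forall i, g i < K)%N ->
  (\sum_i f i * K ^ i = \sum_i g i * K ^ i)%N -> f =1 g.
Proof.
elim: m f g => [|m IH] f g fK gK; first by move=> _ [].
rewrite !big_ord_recl !expn0 !muln1 => e.
have K0 : (0 < K)%N by apply: leq_ltn_trans (fK ord0).
have shift (h : 'I_m.+1 -> nat) :
    (\sum_(i < m) h (lift ord0 i) * K ^ lift ord0 i
     = (\sum_(i < m) h (lift ord0 i) * K ^ i) * K)%N.
  by rewrite big_distrl; apply: eq_bigr => i _; rewrite /= expnSr mulnA.
rewrite !shift in e.
have e0 : f ord0 = g ord0.
  by move/(congr1 (modn^~ K)): e; rewrite ![(_ + _ * K)%N]addnC !modnMDl !modn_small.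
move/eqP: e; rewrite e0 eqn_add2l eqn_pmul2r // => /eqP /IH e i.
by case: (unliftP ord0 i) => [j|] -> //; apply: e.
Qed.

Section Identities.
Context {R : realType}.

(** By continuity [W] is positive on a neighbourhood of [t0], so [p - q] has
infinitely many roots.  The positivity of [W] serves to express at once that
finitely many denominators are nonzero and that the multiplier is positive. *)
Lemma poly_eq_near (W p q : {poly R}) (t0 : R) :
  0 < W.[t0] -> (forall t, 0 < W.[t] -> p.[t] = q.[t]) -> p = q.
Proof.
move=> W0 epq; apply/eqP; rewrite -subr_eq0; apply/eqP.
have /cvgrPdist_lt /(_ _ W0) := @continuous_horner R W t0.
case/nbhs_ballP => e /= e0 near0.
pose rs := [seq t0 + e / i.+2%:R | i <- iota 0 (size (p - q))].
apply: (@roots_geq_poly_eq0 _ _ rs); last by rewrite size_map size_iota.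
- apply/allP => _ /mapP[i _ ->]; rewrite rootE !hornerE epq ?subrr //.
  have /near0 : ball t0 e (t0 + e / i.+2%:R).
    rewrite /ball /= opprD addrA subrr add0r normrN ger0_norm.
      by rewrite ltr_pdivrMr ?ltr0n // ltr_pMr // ltr1n.
    by rewrite divr_ge0 ?ler0n // ltW.
  move=> /= h.
  by have := le_lt_trans (ler_norm _) h; rewrite gtrBl.
- rewrite map_inj_uniq ?iota_uniq // => i j /addrI/mulfI.
  by rewrite gt_eqF // => /(_ isT)/invr_inj/eqP; rewrite eqr_nat => /eqP[].
Qed.

(** Kronecker substitution: for [K] larger than all exponents, replacing the
[i]-th variable by the [K ^ i]-th power of one variable keeps the monomials
distinct, and a nonzero univariate polynomial has a nonzero value. *)
Lemma mpoly_nonroot m (P : {mpoly R[m]}) : P != 0 -> exists v, P.@[v] != 0.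
Proof.
move=> P0; have [//|no] := pselect (exists v, P.@[v] != 0).
pose K := msize P.
pose h (u : 'X_{1..m}) := (\sum_i u i * K ^ i)%N.
have uK (u : 'X_{1..m}) : u \in msupp P -> forall i, (u i < K)%N.
  move=> /msize_mdeg_lt uP i; apply: leq_ltn_trans uP.
  by rewrite mdegE (bigD1 i) //= leq_addr.
pose p : {poly R} := \sum_(u <- msupp P) P@_u *: 'X^(h u).
suff p0 : p = 0.
  have := mleadc_eq0 P; rewrite (negPf P0) => /negP[]; apply/eqP.
  have /(congr1 (fun q : {poly R} => q`_(h (mlead P)))) := p0.
  have sup := mlead_supp P0.
  rewrite coef0 coef_sum (bigD1_seq (mlead P)) ?msupp_uniq //= coefZ coefXn.
  rewrite eqxx mulr1 big_seq_cond big1 ?addr0 // => u /andP[uP uN].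
  rewrite coefZ coefXn; case: eqP => [e|_]; last by rewrite mulr0.
  case/eqP: uN; apply/mnmP => i.
  by apply: (radix_inj (K := K)) i; [exact: uK | exact: uK | exact: esym e].
apply: (@poly_eq_near 1 _ _ 0); first by rewrite hornerC.
move=> t _; rewrite horner0.
transitivity (P.@[fun i => t ^+ (K ^ i)]).
  rewrite mevalE /p horner_sum; apply: eq_bigr => u _.
  rewrite hornerZ hornerXn /h -prodrXr; congr (_ * _).
  by apply: eq_bigr => i _; rewrite -exprM mulnC.
by apply/eqP; apply/negPn/negP => nz; apply: no; exists (fun i : 'I_m => t ^+ (K ^ i)).
Qed.

Lemma mpoly_eq_where m (W P Q : {mpoly R[m]}) : W != 0 ->
  (forall v, W.@[v] != 0 -> P.@[v] = Q.@[v]) -> P = Q.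
Proof.
move=> W0 ePQ; apply/eqP; rewrite -subr_eq0; apply/negPn/negP => nz.
have /mpoly_nonroot[v] : W * (P - Q) != 0 by rewrite mulf_neq0.
by rewrite mevalM mevalB mulf_eq0 negb_or => /andP[/ePQ ->]; rewrite subrr eqxx.
Qed.

End Identities.

(** A ring [A] of regular functions with evaluations [e : A -> R] stands for two
cases: polynomials in the coordinates of a configuration when the matrix is
fixed, and polynomials in [t] when the matrix moves along a curve and the
configuration is fixed. *)
Section ClearDenominators.
Context {R : realType} {m : nat} {A : comNzRingType} (j : {rmorphism R -> A}).
Implicit Types (a : 'I_m -> A) (u : A) (P : {mpoly R[m]}).

(** The numerator of [P (a / u)] over the denominator [u ^+ N]; it is the value at
[(a, u)] of the homogenization of [P] in degree [N]. *)
Definition clear_den a u (N : nat) P : A :=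
  \sum_(k <- msupp P) j P@_k * \prod_i a i ^+ k i * u ^+ (N - mdeg k).

Lemma clear_denE (e : {rmorphism A -> R}) a u N P :
  (forall c, e (j c) = c) -> e u != 0 -> (msize P <= N)%N ->
  e (clear_den a u N P) = P.@[fun i => e (a i) / e u] * e u ^+ N.
Proof.
move=> ej u0 PN; rewrite mevalE mulr_suml rmorph_sum; apply: eq_big_seq => k kP.
rewrite !rmorphM rmorphXn rmorph_prod ej /= -!mulrA; congr (_ * _).
under eq_bigr do rewrite rmorphXn.
under [in RHS]eq_bigr do rewrite expr_div_n.
rewrite big_split /= -mulrA; congr (_ * _).
have kN : (mdeg k <= N)%N by apply: ltnW; apply: leq_trans (msize_mdeg_lt kP) PN.
rewrite prodfV prodrXr -mdegE -{2}(subnK kN) exprD mulrCA mulVf ?mulr1 //.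
by rewrite expf_neq0.
Qed.

End ClearDenominators.

(** * Fractions and subfields *)

Lemma fracE (A : idomainType) (F : {fraction A}) :
  exists P Q : A, Q != 0 /\ F = FracField.tofrac P / FracField.tofrac Q.
Proof.
elim/quotW: F => x; have d0 := denom_ratioP x.
exists (frac x).1, (frac x).2; split=> //; apply/eqP.
rewrite -[X in _ == X]/(FracField.mul _ (FracField.inv _)) !piE /=.
rewrite FracField.equivfE /FracField.mulf /FracField.invf /=.
by rewrite !numden_Ratio ?oner_eq0 ?mulr1 ?mul1r // mulrC.
Qed.

Section Subfields.
Context {K : fieldType}.
Implicit Types (S A : set K).

Lemma subfieldP S : subfield S <->
  [/\ S 1, (forall x y, S x -> S y -> S (x - y)) & (forall x y, S x -> S y -> S (x / y))].
Proof.
split=> [[h1 h2 h3]|[h1 h2 h3]].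
  split=> [|x y Sx Sy|x y Sx Sy]; apply: set_mem => //.
    by apply: h2; apply: mem_set.
  by apply: h3; apply: mem_set.
split=> [|x y /set_mem Sx /set_mem Sy|x y /set_mem Sx /set_mem Sy]; apply: mem_set => //.
  exact: h2.
exact: h3.
Qed.

Lemma subfield_gen_subfield A : subfield (subfield_gen A).
Proof.
apply/subfieldP; split=> [S [/subfieldP[h _ _] _] //|x y Sx Sy S hS|x y Sx Sy S hS].
  by have [/subfieldP[_ h _] _] := hS; apply: h; [exact: Sx | exact: Sy].
by have [/subfieldP[_ _ h] _] := hS; apply: h; [exact: Sx | exact: Sy].
Qed.

Lemma subfield0 S : subfield S -> S 0.
Proof. by case/subfieldP => h1 hB _; rewrite -(subrr 1); apply: hB. Qed.

Lemma subfieldM S x y : subfield S -> S x -> S y -> S (x * y).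
Proof.
case/subfieldP => h1 _ hD Sx Sy; rewrite -[y]invrK; apply: (hD) => //.
by rewrite -div1r; apply: hD.
Qed.

Lemma subfieldXz S x (k : int) : subfield S -> S x -> S (x ^ k).
Proof.
move=> hS Sx; have [h1 _ hD] := (subfieldP S).1 hS.
have hX (m : nat) : S (x ^+ m).
  elim: m => [|m IH]; first exact: h1.
  by rewrite exprS; apply: subfieldM.
case: k => m; first exact: hX.
by rewrite NegzE -exprnN -div1r; apply: hD (hX _).
Qed.

End Subfields.

(** * The action in homogeneous coordinates *)

Lemma sum3 (A : nmodType) (F : 'I_3 -> A) :
  \sum_i F i = F fst3 + F snd3 + F thd3.
Proof.
rewrite !big_ord_recl big_ord0 addr0 addrA.
by congr (F _ + F _ + F _); apply: val_inj.
Qed.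

Lemma ord3_ind (P : 'I_3 -> Prop) : P fst3 -> P snd3 -> P thd3 -> forall r, P r.
Proof.
by move=> P1 P2 P3 [[|[|[|//]]] lt_r];
  [move: P1 | move: P2 | move: P3]; congr P; apply: val_inj.
Qed.

Lemma ord4_ind (P : 'I_4 -> Prop) : P kx -> P ky -> P kp -> P kq -> forall k, P k.
Proof.
by move=> P1 P2 P3 P4 [[|[|[|[|//]]]] lt_k];
  [move: P1 | move: P2 | move: P3 | move: P4]; congr P; apply: val_inj.
Qed.

Section Homogeneous.
Context {A : comNzRingType} {n : nat}.
Implicit Types (T : 'M[A]_3) (X : 'M[A]_(n, 4)) (i j k : 'I_n).

(** The contact element of block [i] in the projective plane: its point is [hpt],
and [hcv] is the line through it with normal [(p, q)]. *)
Definition hpt X i : 'cV[A]_3 := \col_r [:: X i kx; X i ky; 1]`_r.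
Definition hcv X i : 'rV[A]_3 :=
  \row_r [:: X i kp; X i kq; - (X i kp * X i kx + X i kq * X i ky)]`_r.
Definition hden T X i : A := (T *m hpt X i) thd3 0.

Definition pdelta X i j k : A :=
  X i kx * (X j ky - X k ky) - X j kx * (X i ky - X k ky)
    + X k kx * (X i ky - X j ky).
Definition pPhi X k i j : A :=
  (X i kx - X j kx) * X k kp + (X i ky - X j ky) * X k kq.

Lemma linf_hpt T (r : 'I_3) X i :
  (T *m hpt X i) r 0 = T r fst3 * X i kx + T r snd3 * X i ky + T r thd3.
Proof. by rewrite mxE sum3 !mxE /= mulr1. Qed.

Lemma hcv_hpt X k j : (hcv X k *m hpt X j) 0 0 = - pPhi X k k j.
Proof. by rewrite mxE sum3 !mxE /= /pPhi; ring. Qed.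

Lemma hcvE X i : (hcv X i 0 fst3 = X i kp) * (hcv X i 0 snd3 = X i kq) *
  (hcv X i 0 thd3 = - (X i kp * X i kx + X i kq * X i ky)).
Proof. by rewrite !mxE. Qed.

Lemma hptE X i : (hpt X i fst3 0 = X i kx) * (hpt X i snd3 0 = X i ky) *
  (hpt X i thd3 0 = 1).
Proof. by rewrite !mxE. Qed.

Lemma hpt_inj X Y i j : hpt X i = hpt Y j -> X i kx = Y j kx /\ X i ky = Y j ky.
Proof. by move=> e; rewrite -!(hptE X) e !hptE. Qed.

Lemma hcv_inj X Y i j : hcv X i = hcv Y j -> X i kp = Y j kp /\ X i kq = Y j kq.
Proof. by move=> e; rewrite -!(hcvE X) e !hcvE. Qed.

End Homogeneous.

Lemma map_hpt (A B : comNzRingType) (e : {rmorphism A -> B}) n (X : 'M[A]_(n, 4)) i :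
  map_mx e (hpt X i) = hpt (map_mx e X) i.
Proof. by apply/matrixP => r c; elim/ord3_ind: r; rewrite !mxE //= rmorph1. Qed.

Lemma map_hcv (A B : comNzRingType) (e : {rmorphism A -> B}) n (X : 'M[A]_(n, 4)) i :
  map_mx e (hcv X i) = hcv (map_mx e X) i.
Proof.
by apply/matrixP => r c; elim/ord3_ind: c; rewrite !mxE //= rmorphN rmorphD !rmorphM.
Qed.

Lemma map_hden (A B : comNzRingType) (e : {rmorphism A -> B}) n T (X : 'M[A]_(n, 4)) i :
  e (hden T X i) = hden (map_mx e T) (map_mx e X) i.
Proof. by rewrite /hden -map_hpt -map_mxM [RHS]mxE. Qed.

Lemma map_pdelta (A B : comNzRingType) (e : {rmorphism A -> B}) n
    (X : 'M[A]_(n, 4)) i j k :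
  e (pdelta X i j k) = pdelta (map_mx e X) i j k.
Proof. by rewrite /pdelta rmorphD rmorphB !rmorphM !rmorphB !mxE. Qed.

Lemma map_pPhi (A B : comNzRingType) (e : {rmorphism A -> B}) n
    (X : 'M[A]_(n, 4)) k i j :
  e (pPhi X k i j) = pPhi (map_mx e X) k i j.
Proof. by rewrite /pPhi rmorphD !rmorphM !rmorphB !mxE. Qed.

Section Action.
Context {R : realType} {n : nat}.
Implicit Types (S T : 'M[R]_3) (x y z : config R n) (s : 'I_n -> R).

Lemma deltaE x i j k : delta x i j k = pdelta x i j k.
Proof.
rewrite /delta (expand_det_row _ ord0) !big_ord_recl big_ord0 /cofactor.
rewrite !(expand_det_row _ ord0) !big_ord_recl !big_ord0 /cofactor !det_mx11.
by rewrite !mxE /= !(tnth_nth i) /= /bump /= /pdelta; ring.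
Qed.

Lemma sden_hden T x i : sden T x i = hden T x i.
Proof. by rewrite /hden linf_hpt. Qed.

(** The covector condition is the chain rule of the first prolongation together
with the incidence of the contact line and its point.  In this form, inverses and
composites of transformations are matters of matrix algebra. *)
Definition related T s x y := forall i,
  [/\ s i != 0, T *m hpt x i = s i *: hpt y i & hcv y i *m T = s i *: hcv x i].

Lemma act_related T x : T \in unitmx -> (forall i, sden T x i != 0) ->
  related T (sden T x) x (mxact T x).
Proof.
move=> uT nz i; have si := nz i; split => //.
  apply/matrixP => r c; rewrite {c}(ord1 c) linf_hpt -/(linf T r _ _).
  by elim/ord3_ind: r; rewrite !mxE /= /projx /projy -/(sden T x i) ?mulr1
    // mulrCA divff ?mulr1.
have [] := mxact_prolong uT si; set y := mxact T x.
have ex : y i kx = linf T fst3 (x i kx) (x i ky) / sden T x i by rewrite mxE.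
have ey : y i ky = linf T snd3 (x i kx) (x i ky) / sden T x i by rewrite mxE.
have eyp : y i kp = cograd T (x i kx) (x i ky) (x i kp) (x i kq) 0 0 by rewrite mxE.
have eyq : y i kq = cograd T (x i kx) (x i ky) (x i kp) (x i kq) 0 1 by rewrite mxE.
have e0 : widen_ord (isT : 2 <= 3)%N ord0 = fst3 by apply: val_inj.
have e1 : widen_ord (isT : 2 <= 3)%N (lift ord0 ord0) = snd3 by apply: val_inj.
have /matrixP D := projDE (T := T) (a := x i kx) (b := x i ky) si.
have := D ord0 ord0; have := D ord0 (lift ord0 ord0).
have := D (lift ord0 ord0) ord0; have := D (lift ord0 ord0) (lift ord0 ord0).
rewrite !mxE /= !e0 !e1 -/(sden T x i) -eyp -eyq.
move=> -> -> -> -> ep eq {D eyp eyq}.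
apply/matrixP => r c; rewrite {r}(ord1 r) [LHS]mxE [RHS]mxE sum3.
rewrite /sden /linf in ex ey ep eq si *.
elim/ord3_ind: c; rewrite !hcvE ex ey ?ep ?eq; field; exact: si.
Qed.

Lemma related_inv T s x y : T \in unitmx -> related T s x y ->
  related (invmx T) (fun i => (s i)^-1) y x.
Proof.
move=> uT h i; have [si hp hc] := h i; split; first by rewrite invr_eq0.
  by rewrite -[hpt x i](mulKmx uT) hp -scalemxAr scalerA mulVf ?scale1r.
by rewrite -[hcv y i](mulmxK uT) hc -scalemxAl scalerA mulVf ?scale1r.
Qed.

Lemma related_comp S T s s' x y z : related S s x y -> related T s' y z ->
  related (T *m S) (fun i => s i * s' i) x z.
Proof.
move=> hS hT i; have [si hp hc] := hS i; have [s'i hp' hc'] := hT i.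
split; first by rewrite mulf_neq0.
  by rewrite -mulmxA hp -scalemxAr hp' scalerA.
by rewrite mulmxA hc' -scalemxAl hc scalerA mulrC.
Qed.

Lemma related_sden T s x y i : related T s x y -> sden T x i = s i.
Proof.
by case/(_ i) => _ + _; rewrite sden_hden /hden => ->; rewrite mxE hptE mulr1.
Qed.

Lemma related_act T s x y : T \in unitmx -> related T s x y -> y = mxact T x.
Proof.
move=> uT h.
have es i : sden T x i = s i by apply: related_sden h.
have nz i : sden T x i != 0 by rewrite es; case: (h i).
apply/matrixP => i k; have [s0 hp hc] := h i.
have [_ hp' hc'] := act_related uT nz i; rewrite es in hp' hc'.
have /hpt_inj[ex ey] : hpt y i = hpt (mxact T x) i.
  by apply: (scalerI s0); rewrite -hp -hp'.
have /hcv_inj[ep eq] : hcv y i = hcv (mxact T x) i.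
  by apply: (can_inj (mulmxK uT)); rewrite hc hc'.
by elim/ord4_ind: k.
Qed.

Lemma mxact1 x : mxact 1%:M x = x /\ forall i, sden 1%:M x i = 1.
Proof.
have h : related 1%:M (fun=> 1) x x.
  by move=> i; rewrite oner_neq0 mul1mx mulmx1 !scale1r.
split=> [|i]; last exact: related_sden h.
by rewrite -(related_act _ h) // unitmx1.
Qed.

Lemma mxactK T x : T \in unitmx -> (forall i, sden (invmx T) x i != 0) ->
  mxact T (mxact (invmx T) x) = x /\
  (forall i, sden T (mxact (invmx T) x) i != 0).
Proof.
move=> uT nz; have uV : invmx T \in unitmx by rewrite unitmx_inv.
have := related_inv uV (act_related uV nz); rewrite invmxK => h.
split=> [|i]; first by rewrite -(related_act uT h).
by rewrite (related_sden i h); case: (h i).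
Qed.

Lemma pdelta_det x i j k (P : 'M[R]_3) :
  (forall r, P r fst3 = hpt x i r 0) -> (forall r, P r snd3 = hpt x j r 0) ->
  (forall r, P r thd3 = hpt x k r 0) -> \det P = pdelta x i j k.
Proof.
move=> h1 h2 h3; rewrite -deltaE; congr (\det _); apply/matrixP => r c.
by elim/ord3_ind: c; rewrite ?h1 ?h2 ?h3 !mxE /=.
Qed.

(** Multiplicativity of the determinant, applied to the three points. *)
Lemma related_delta T s x y i j k : related T s x y ->
  \det T * pdelta x i j k = s i * s j * s k * pdelta y i j k.
Proof.
move=> h; pose l c := tnth [tuple i; j; k] c.
pose P (z : config R n) : 'M[R]_3 := \matrix_(r, c) hpt z (l c) r 0.
have dP z : \det (P z) = pdelta z i j k.
  by apply: pdelta_det => r; rewrite mxE.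
have eTP : T *m P x = P y *m diag_mx (\row_c s (l c)).
  apply/matrixP => r c; have [_ /matrixP /(_ r 0) e _] := h (l c).
  rewrite mul_mx_diag !mxE [s _ * _]mulrC in e *.
  by rewrite -e; apply: eq_bigr => t _; rewrite mxE.
rewrite -!dP -det_mulmx eTP det_mulmx det_diag mulrC; congr (_ * _).
by rewrite !big_ord_recl big_ord0 !mxE mulr1 mulrA.
Qed.

(** The pairing of the contact line of block [k] with the point of block [j] is
[- Phi], and [T] cancels in it. *)
Lemma related_Phi T s x y k j : related T s x y ->
  s k * pPhi x k k j = s j * pPhi y k k j.
Proof.
move=> h; have [_ _ hc] := h k; have [_ hp _] := h j.
apply: oppr_inj; rewrite -!mulrN -!hcv_hpt.
have /matrixP /(_ 0 0) := mulmxA (hcv y k) T (hpt x j).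
by rewrite hc hp -scalemxAl -scalemxAr mxE [RHS]mxE.
Qed.

End Action.

(** * Pulling rational functions back along the action *)

Section Pullback.
Context {R : realType} {n : nat} {A : comNzRingType} (j : {rmorphism R -> A}).
Implicit Types (T : 'M[A]_3) (X : 'M[A]_(n, 4)).

Definition act_den T X : A := \det T * \prod_i hden T X i.

(** The coordinates of the transformed configuration over the common denominator
[act_den T X]; the covectors are [s_i / det T] times the products with the
adjugate. *)
Definition act_num T X : 'M[A]_(n, 4) := \matrix_(i, k)
  [:: (T *m hpt X i) fst3 0 * (\det T * \prod_(l | l != i) hden T X l);
      (T *m hpt X i) snd3 0 * (\det T * \prod_(l | l != i) hden T X l);
      hden T X i * (hcv X i *m \adj T) 0 fst3 * \prod_l hden T X l;
      hden T X i * (hcv X i *m \adj T) 0 snd3 * \prod_l hden T X l]`_k.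

Definition act_pullback T X N (P : {mpoly R[n * 4]}) : A :=
  clear_den j (fun k => mxvec (act_num T X) 0 k) (act_den T X) N P.

Context (e : {rmorphism A -> R}) (ej : forall c, e (j c) = c).

Lemma act_denE T X :
  e (act_den T X) = \det (map_mx e T) * \prod_i sden (map_mx e T) (map_mx e X) i.
Proof.
rewrite rmorphM rmorph_prod det_map_mx; congr (_ * _).
by apply: eq_bigr => i _; rewrite sden_hden -map_hden.
Qed.

Lemma act_numE T X i k : e (act_den T X) != 0 ->
  mxact (map_mx e T) (map_mx e X) i k = e (act_num T X i k) / e (act_den T X).
Proof.
move=> u0; have := u0; rewrite {1}act_denE mulf_eq0 negb_or => /andP[dT /prodf_neq0 s0].
have {}s0 l : sden (map_mx e T) (map_mx e X) l != 0 by exact: s0.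
have uT : map_mx e T \in unitmx by rewrite unitmxE unitfE.
have [si /matrixP hp hc] := act_related uT s0 i.
have eu : e (act_den T X) = e (\det T) * (e (hden T X i) * e (\prod_(l | l != i) hden T X l)).
  by rewrite /act_den (bigD1 i) //= !rmorphM.
have es : sden (map_mx e T) (map_mx e X) i = e (hden T X i) by rewrite sden_hden -map_hden.
have {hc} hc : hcv (mxact (map_mx e T) (map_mx e X)) i =
    (e (hden T X i) / e (\det T)) *: map_mx e (hcv X i *m \adj T).
  rewrite -[LHS](mulmxK uT) hc es /invmx uT -scalemxAl -scalemxAr scalerA.
  by rewrite -map_hcv map_mxM map_mx_adj det_map_mx.
rewrite -map_hpt -map_mxM es in hp.
have nz := u0; rewrite eu !mulf_eq0 !negb_or in nz; case/and3P: nz => d0 n0 p0.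
have hx r c : (map_mx e (T *m hpt X i)) r c = e ((T *m hpt X i) r 0).
  by rewrite (ord1 c) mxE.
move: hc hp; set y := mxact _ _ => /matrixP hc hp.
elim/ord4_ind: k; rewrite [in RHS]mxE /= eu !rmorphM.
- have := hp fst3 0; rewrite hx [RHS]mxE hptE => ->; field; exact/and3P.
- have := hp snd3 0; rewrite hx [RHS]mxE hptE => ->; field; exact/and3P.
- have := hc 0 fst3; rewrite hcvE [RHS]mxE [map_mx _ _ _ _]mxE => ->.
  by rewrite (bigD1 i) //= rmorphM; field; exact/and3P.
- have := hc 0 snd3; rewrite hcvE [RHS]mxE [map_mx _ _ _ _]mxE => ->.
  by rewrite (bigD1 i) //= rmorphM; field; exact/and3P.
Qed.

Lemma act_pullbackE T X N P : e (act_den T X) != 0 -> (msize P <= N)%N ->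
  e (act_pullback T X N P) =
  peval P (mxact (map_mx e T) (map_mx e X)) * e (act_den T X) ^+ N.
Proof.
move=> u0 PN; rewrite clear_denE //; congr (_ * _); apply: meval_eq => q.
by case/mxvec_indexP: q => i k; rewrite !mxvecE act_numE.
Qed.

End Pullback.

Section Generic.
Context {R : realType} {n : nat}.
Implicit Types (T : 'M[R]_3) (x : config R n) (P Q : {mpoly R[n * 4]}).

(** The generic configuration, whose entries are the coordinate functions. *)
Definition Xgen : 'M[{mpoly R[n * 4]}]_(n, 4) := \matrix_(i, k) 'X_(mxvec_index i k).

Definition evalat x : {mpoly R[n * 4]} -> R := meval (fun k => mxvec x 0 k).
HB.instance Definition _ x := GRing.RMorphism.on (evalat x).

Lemma pevalE P x : peval P x = evalat x P. Proof. by []. Qed.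

Lemma pevalM P Q x : peval (P * Q) x = peval P x * peval Q x.
Proof. exact: rmorphM (evalat x) P Q. Qed.

Lemma pevalXn P k x : peval (P ^+ k) x = peval P x ^+ k.
Proof. exact: rmorphXn (evalat x) k P. Qed.

Lemma map_Xgen x : map_mx (evalat x) Xgen = x.
Proof. by apply/matrixP => i k; rewrite !mxE /evalat mevalXU mxvecE. Qed.

Lemma peval_nonroot P : P != 0 -> exists x, peval P x != 0.
Proof.
case/mpoly_nonroot => v nz; exists (vec_mx (\row_k v k)).
by apply: contraNneq nz => <-; apply/eqP/meval_eq => k; rewrite vec_mxK mxE.
Qed.

Lemma peval_eq_generically P Q : generically (fun x => peval P x = peval Q x) -> P = Q.
Proof.
case=> W W0 ePQ; apply: (mpoly_eq_where W0) => v nz.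
have ev S : S.@[v] = peval S (vec_mx (\row_k v k)).
  by apply: meval_eq => k; rewrite vec_mxK mxE.
by rewrite !ev; apply: ePQ; rewrite -ev.
Qed.

Lemma generically_and (p q : config R n -> Prop) :
  generically p -> generically q -> generically (fun x => p x /\ q x).
Proof.
move=> [P P0 hP] [Q Q0 hQ]; exists (P * Q); first by rewrite mulf_neq0.
by move=> x; rewrite pevalE rmorphM mulf_eq0 negb_or => /andP[/hP ? /hQ ?].
Qed.

Lemma generically_imp (p q : config R n -> Prop) :
  (forall x, p x -> q x) -> generically p -> generically q.
Proof. by move=> pq [P P0 hP]; exists P => // x /hP /pq. Qed.

Lemma generically_neq0 P x0 : peval P x0 != 0 ->
  generically (fun x => peval P x != 0).
Proof.
move=> nz; exists P => //; apply: contraNneq nz => ->.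
by rewrite pevalE rmorph0.
Qed.

Lemma generically_ex p : generically p -> exists x : config R n, p x.
Proof. by case=> P /peval_nonroot[x nz] /(_ x nz); exists x. Qed.

Lemma map_mpolyC_mx m1 m2 x (T : 'M[R]_(m1, m2)) :
  map_mx (evalat x) (map_mx (@mpolyC (n * 4) R) T) = T.
Proof. by apply/matrixP => i k; rewrite !mxE /evalat mevalC. Qed.

(** The case of a constant matrix acting on the generic configuration. *)
Definition cden T : {mpoly R[n * 4]} := act_den (map_mx (@mpolyC (n * 4) R) T) Xgen.
Definition cpull T N P : {mpoly R[n * 4]} :=
  act_pullback (@mpolyC (n * 4) R) (map_mx (@mpolyC (n * 4) R) T) Xgen N P.

Lemma cdenE T x : peval (cden T) x = \det T * \prod_i sden T x i.
Proof. by rewrite pevalE act_denE map_mpolyC_mx map_Xgen. Qed.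

Lemma cden_neq0 T x : T \in unitmx ->
  (peval (cden T) x != 0) <-> (forall i, sden T x i != 0).
Proof.
rewrite unitmxE unitfE cdenE => dT; rewrite mulf_eq0 (negPf dT) /=.
by split=> [/prodf_neq0 h i|h]; [exact: h | apply/prodf_neq0 => i _].
Qed.

Lemma cpullE T N P x : T \in unitmx -> (forall i, sden T x i != 0) ->
  (msize P <= N)%N ->
  peval (cpull T N P) x = peval P (mxact T x) * peval (cden T) x ^+ N.
Proof.
move=> uT nz PN.
rewrite pevalE act_pullbackE ?map_mpolyC_mx ?map_Xgen //; last exact/cden_neq0.
by move=> c; exact: mevalC.
Qed.

Lemma generically_sden T : T \in unitmx ->
  generically (fun x => forall i, sden T x i != 0).
Proof.
move=> uT; suff [a [b ab0]] : exists a b, linf T thd3 a b != 0.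
  pose x : config R n := \matrix_(i, k) [:: a; b; 0; 0]`_k.
  have h : peval (cden T) x != 0.
    by apply/(cden_neq0 _ uT) => i; rewrite /sden !mxE.
  by apply: generically_imp (generically_neq0 h) => y /(cden_neq0 _ uT).
have [//|no] := pselect (exists a b, linf T thd3 a b != 0).
have z a b : linf T thd3 a b = 0.
  by apply/eqP/negPn/negP => nz; apply: no; exists a, b.
have := z 0 0; rewrite /linf !mulr0 !add0r => T3.
have := z 1 0; rewrite /linf mulr1 mulr0 T3 !addr0 => T1.
have := z 0 1; rewrite /linf mulr1 mulr0 T3 addr0 add0r => T2.
suff /det0P dT : exists2 v : 'rV[R]_3, v != 0 & v *m T = 0.
  by move: uT; rewrite unitmxE unitfE; case/negP.
exists (delta_mx 0 thd3).
  apply/eqP => /matrixP /(_ 0 thd3); rewrite !mxE !eqxx => /eqP.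
  by rewrite oner_eq0.
by rewrite -rowE; apply/matrixP => r c; rewrite !mxE; elim/ord3_ind: c.
Qed.

(** The exceptional polynomial of [p], pulled back by [T], is nonzero since the
inverse of [T] provides points at which it does not vanish. *)
Lemma generically_act T p : T \in unitmx -> generically p ->
  generically (fun x => (forall i, sden T x i != 0) /\ p (mxact T x)).
Proof.
move=> uT gp; have [P P0 hP] := gp.
have uV : invmx T \in unitmx by rewrite unitmx_inv.
have [z [nz Pz]] : exists z, (forall i, sden (invmx T) z i != 0) /\ peval P z != 0.
  by apply: generically_ex; apply: generically_and (generically_sden uV) _; exists P.
have [ez nx] := mxactK uT nz.
pose B := cpull T (msize P) P.
have Bx : peval B (mxact (invmx T) z) != 0.
  rewrite cpullE // ez mulf_neq0 // expf_neq0 //; exact/cden_neq0.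
apply: generically_imp (generically_and (generically_sden uT) (generically_neq0 Bx)).
move=> x [sx]; rewrite cpullE // mulf_eq0 negb_or => /andP[/hP px _].
by split.
Qed.

End Generic.

Section Evaluation.
Context {R : realType} {n : nat}.
Implicit Types (F G : ratfun R n) (x : config R n).

Lemma fevalM F G x v w : feval F x v -> feval G x w -> feval (F * G) x (v * w).
Proof.
move=> [P [Q [-> Q0 ->]]] [P' [Q' [-> Q'0 ->]]].
exists (P * P'), (Q * Q'); rewrite !tofracM !pevalE !rmorphM /=; split.
- by rewrite mulf_div.
- by rewrite mulf_neq0.
- by rewrite mulf_div.
Qed.

Lemma fevalV F x v : v != 0 -> feval F x v -> feval F^-1 x v^-1.
Proof.
move=> v0 [P [Q [-> Q0 ev]]]; exists Q, P; rewrite invf_div ev invf_div; split=> //.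
by apply: contraNneq v0 => P0; rewrite ev P0 mul0r.
Qed.

Lemma feval1 x : @feval R n 1 x 1.
Proof. by exists 1, 1; rewrite !pevalE !rmorph1 !divr1 oner_neq0. Qed.

Lemma fevalXz F x v (k : int) : v != 0 -> feval F x v -> feval (F ^ k) x (v ^ k).
Proof.
move=> v0 hF; have hX (m : nat) : feval (F ^+ m) x (v ^+ m).
  elim: m => [|m IH]; first exact: feval1.
  by rewrite !exprS; apply: fevalM.
case: k => m; first exact: hX.
by rewrite NegzE -!exprnN; apply: fevalV (hX _); rewrite expf_neq0.
Qed.

End Evaluation.

(** * Rational powers *)

Section RationalPower.
Context {R : realType}.

Lemma numq_frac (k : int) (d : nat) : (0 < d)%N ->
  numq (k%:~R / d%:R) * d%:Z = k * denq (k%:~R / d%:R).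
Proof.
move=> d0; set w : rat := _ / _; apply: (intr_inj (R := rat)); rewrite !intrM.
have := divq_num_den w; rewrite {3}/w => /eqP.
by rewrite eqr_div ?intr_eq0 ?denq_neq0 ?pnatr_eq0 -?lt0n // => /eqP.
Qed.

Lemma denq_frac_dvd (k : int) (d : nat) : (0 < d)%N ->
  (`|denq (k%:~R / d%:R)|%N %| d)%N.
Proof.
move=> d0; have e := numq_frac k d0; set w : rat := _ / _ in e *.
have cop : coprimez (denq w) (numq w) by rewrite coprimez_sym; exact: coprime_num_den.
change (denq w %| d%:Z)%Z.
by rewrite -(Gauss_dvdzr _ cop) e dvdz_mull.
Qed.

Lemma odd_denq_frac (k : int) (d : nat) : odd d -> odd `|denq (k%:~R / d%:R)|%N.
Proof. by move=> od; apply: (dvdn_odd (denq_frac_dvd k (odd_gt0 od))). Qed.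

Lemma rpow_def_root (d : nat) (k : int) (c : R) : odd d -> c != 0 ->
  rpow_def (c ^+ d) (k%:~R / d%:R).
Proof.
move=> od c0; rewrite /rpow_def expf_neq0 //=; rewrite odd_denq_frac ?orbT //.
Qed.

(** For odd [d] the numerator of [k / d] has the parity of [k], so the signs of both
sides agree; absolute values are compared by the laws of real exponents. *)
Lemma rpow_root (d : nat) (k : int) (c : R) : odd d -> c != 0 ->
  rpow (c ^+ d) (k%:~R / d%:R) = c ^ k.
Proof.
move=> od c0; have e := numq_frac k (odd_gt0 od).
have := odd_denq_frac k od; set w : rat := _ / _ in e * => oq.
have sgo (m : nat) (z : int) : odd m -> Num.sg c ^ (z * m%:Z) = Num.sg c ^ z.
  by move=> om; rewrite mulrC -exprz_exp -exprnP (sgr_odd _ c0) om expr1.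
rewrite /rpow sgrX (sgr_odd _ c0) od expr1 [in RHS](numEsg c) expfzMl.
congr (_ * _).
  by rewrite -(sgo d) // e -{1}(gez0_abs (ltW (denq_gt0 w))) sgo.
rewrite normrX -powR_mulrn // -powRrM -powR_intmul //; congr powR.
rewrite /w fmorph_div /= ratr_int ratr_nat mulrC divfK // pnatr_eq0.
by case: (d) od.
Qed.

Lemma rpow0 (a : R) : rpow a 0 = 1.
Proof. by rewrite /rpow (_ : numq 0 = 0) // expr0z raddf0 powRr0 mulr1. Qed.

Lemma rpowX_denq (a : R) (w : rat) : 0 < a ->
  rpow a w ^+ `|denq w|%N = a ^ numq w.
Proof.
move=> a0; rewrite /rpow gtr0_sg // exp1rz mul1r gtr0_norm //.
rewrite -powR_mulrn ?powR_ge0 // -powRrM -powR_intmul ?ltW //; congr powR.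
rewrite -{1}(divq_num_den w) fmorph_div /= !ratr_int.
have -> : (`|denq w|%N%:R : R) = (denq w)%:~R.
  by rewrite -{2}(gez0_abs (ltW (denq_gt0 w))).
by rewrite divfK // intr_eq0 denq_neq0.
Qed.

End RationalPower.

(** * The weights of relative invariants *)

Section Multiplicity.
Context {F : fieldType}.
Implicit Types (p q : {poly F}) (r : F).

Lemma mup_exp r p m : p != 0 -> mup r (p ^+ m) = (m * mup r p)%N.
Proof.
move=> p0; elim: m => [|m IH]; first by rewrite mupNroot // rootC oner_eq0.
by rewrite exprS mupM ?expf_neq0 // IH mulSn.
Qed.

(** Comparison of the multiplicities of the root [r] on both sides. *)
Lemma mup_power_eq r (a b D S : {poly F}) (c : F) (q p : nat) :
  a != 0 -> b != 0 -> D != 0 -> S != 0 -> c != 0 ->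
  a ^+ q * S ^+ p = c%:P * (b ^+ q * D ^+ p) ->
  (q%:Z %| p%:Z * ((mup r D)%:Z - (mup r S)%:Z))%Z.
Proof.
move=> a0 b0 D0 S0 c0 /(congr1 (mup r)).
rewrite [RHS]mupMr ?rootC // !mupM ?expf_neq0 // !mup_exp // => e.
apply/dvdzP; exists ((mup r a)%:Z - (mup r b)%:Z); nia.
Qed.

End Multiplicity.

Section Weights.
Context {R : realType} {n : nat}.
Implicit Types (F : ratfun R n) (x : config R n) (T : 'M[R]_3).

Lemma rel_inv_mx omega F T x v w : rel_inv omega F ->
  T \in unitmx -> (forall i, sden T x i != 0) -> rpow_def (mxJ T x) omega ->
  feval F x v -> feval F (mxact T x) w -> w = rpow (mxJ T x) omega * v.
Proof.
move=> hF uT sT; rewrite -(jac_pi (exist _ T uT)) -(pact_pi (exist _ T uT)).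
by apply: hF; apply/pact_def_pi.
Qed.

(** Along a polynomial curve [T] through the identity, [F(T x) = a / b] and
[J = D / S] are quotients of polynomials in [t], and
[(a / b)^q = J^p * F(x)^q] if [omega = p / q].  Multiplicities at [r] show that [q]
divides [p] times the order of [J] at [r], and [q] is prime to [p]. *)
Lemma weight_curve omega F (T : 'M[{poly R}]_3) (P Q : {mpoly R[n * 4]}) x t0 r :
  rel_inv omega F -> F = FracField.tofrac P / FracField.tofrac Q ->
  peval P x != 0 -> peval Q x != 0 -> map_mx (horner_eval t0) T = 1%:M ->
  (denq omega %| (mup r (\det T ^+ n))%:Z
     - (mup r (\prod_i hden T (map_mx polyC x) i ^+ 3))%:Z)%Z.
Proof.
move=> hF eF Px Qx T1.
set X := map_mx polyC x; set D := _ ^+ n; set S := \prod_i _.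
have eX t : map_mx (horner_eval t) X = x.
  by apply/matrixP => i k; rewrite !mxE /horner_eval hornerC.
have ej t c : horner_eval t (polyC c) = c :> R by rewrite /horner_eval hornerC.
pose N := maxn (msize P) (msize Q).
have PN : (msize P <= N)%N by rewrite leq_maxl.
have QN : (msize Q <= N)%N by rewrite leq_maxr.
pose u := act_den T X.
pose a := act_pullback (@polyC R) T X N P.
pose b := act_pullback (@polyC R) T X N Q.
have hu t : u.[t] = \det (map_mx (horner_eval t) T) * \prod_i sden (map_mx (horner_eval t) T) x i.
  by have := act_denE (horner_eval t) T X; rewrite eX.
have ha t : u.[t] != 0 -> a.[t] = peval P (mxact (map_mx (horner_eval t) T) x) * u.[t] ^+ N.
  by move=> ut; have := act_pullbackE (ej t) ut PN; rewrite eX.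
have hb t : u.[t] != 0 -> b.[t] = peval Q (mxact (map_mx (horner_eval t) T) x) * u.[t] ^+ N.
  by move=> ut; have := act_pullbackE (ej t) ut QN; rewrite eX.
have hD t : D.[t] = \det (map_mx (horner_eval t) T) ^+ n.
  by rewrite -[LHS]/(horner_eval t D) rmorphXn det_map_mx.
have hS t : S.[t] = \prod_i sden (map_mx (horner_eval t) T) x i ^+ 3.
  rewrite -[LHS]/(horner_eval t S) rmorph_prod; apply: eq_bigr => i _.
  by rewrite rmorphXn map_hden sden_hden eX.
clearbody a b u D S.
have [x1 s1] := mxact1 x.
have u1 : u.[t0] = 1 by rewrite hu T1 det1 mul1r big1.
have u10 : u.[t0] != 0 by rewrite u1 oner_neq0.
have a1 : a.[t0] != 0 by rewrite ha // u1 expr1n mulr1 T1 x1.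
have b1 : b.[t0] != 0 by rewrite hb // u1 expr1n mulr1 T1 x1.
have D1 : D.[t0] = 1 by rewrite hD T1 det1 expr1n.
have S1 : S.[t0] = 1 by rewrite hS T1 big1 // => i _; rewrite s1 expr1n.
have nz (p : {poly R}) : p.[t0] != 0 -> p != 0.
  by apply: contraNneq => ->; rewrite horner0.
pose v := peval P x / peval Q x.
have v0 : v != 0 by rewrite mulf_neq0 ?invr_eq0.
(* Positivity of this polynomial means that [J > 0], where the real power is
   defined for every [omega], and that the action and [F] are defined. *)
have key t : 0 < (D * S * (b * u) ^+ 2).[t] ->
    [/\ b.[t] != 0, D.[t] != 0, S.[t] != 0 &
      a.[t] ^+ `|denq omega|%N = (D.[t] / S.[t]) ^ numq omega * v ^+ `|denq omega|%N * b.[t] ^+ `|denq omega|%N].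
  rewrite !hornerM -expr2 => W0.
  have := lt0r_neq0 W0; rewrite !mulf_eq0 !negb_or -!andbA => /and5P[Dt St bt ut _].
  have W2 : 0 < (b.[t] * u.[t]) ^+ 2 by rewrite exprn_even_gt0 //= mulf_neq0.
  have S2 : 0 < S.[t] ^+ 2 by rewrite exprn_even_gt0.
  have J0 : 0 < D.[t] / S.[t].
    by rewrite -(pmulr_lgt0 _ S2) expr2 mulrA divfK // -(pmulr_lgt0 _ W2).
  split=> //; set Tt := map_mx (horner_eval t) T.
  have := ut; rewrite hu mulf_eq0 negb_or => /andP[dT /prodf_neq0 sT].
  have uT : Tt \in unitmx by rewrite unitmxE unitfE.
  have eJ : mxJ Tt x = D.[t] / S.[t] by rewrite /mxJ hD hS.
  have Qt : peval Q (mxact Tt x) != 0.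
    by move: bt; rewrite hb // mulf_eq0 negb_or => /andP[].
  have : peval P (mxact Tt x) / peval Q (mxact Tt x) = rpow (D.[t] / S.[t]) omega * v.
    rewrite -eJ; apply: (rel_inv_mx hF uT) => [i|||]; first exact: sT.
    - by rewrite eJ /rpow_def J0.
    - by exists P, Q.
    - by exists P, Q.
  move/(canRL (divfK Qt)) => eP; rewrite ha // hb // -/Tt eP -(rpowX_denq _ J0).
  by move: (rpow _ _) => c; rewrite !exprMn; ring.
have W0 : 0 < (D * S * (b * u) ^+ 2).[t0].
  by rewrite !hornerM D1 S1 u1 !mul1r !mulr1 -expr2 exprn_even_gt0.
have cop : coprimez (denq omega) (numq omega) by rewrite coprimez_sym; exact: coprime_num_den.
rewrite -(Gauss_dvdzr _ cop) -(gez0_abs (ltW (denq_gt0 omega))).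
set q := `|denq omega|%N in key *.
have c0 : v ^+ q != 0 by rewrite expf_neq0.
have D0 : D.[t0] != 0 by rewrite D1 oner_neq0.
have S0 : S.[t0] != 0 by rewrite S1 oner_neq0.
(* A negative exponent exchanges the numerator and the denominator of [J]. *)
case: (numq omega) key => p key.
  suff e : a ^+ q * S ^+ p = (v ^+ q)%:P * (b ^+ q * D ^+ p).
    by apply: mup_power_eq c0 e; apply: nz.
  apply: (poly_eq_near W0) => t /key[bt Dt St].
  rewrite !(hornerM, horner_exp, hornerC) -exprnP => ->.
  by rewrite expr_div_n; field; rewrite expf_neq0.
suff e : a ^+ q * D ^+ p.+1 = (v ^+ q)%:P * (b ^+ q * S ^+ p.+1).
  have := mup_power_eq r (nz _ a1) (nz _ b1) (nz _ S0) (nz _ D0) c0 e.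
  by rewrite NegzE mulNr -mulrN opprB.
apply: (poly_eq_near W0) => t /key[bt Dt St].
rewrite !(hornerM, horner_exp, hornerC) NegzE -exprnN => ->.
rewrite expr_div_n invf_div; field; by rewrite expf_neq0.
Qed.

Lemma rel_inv_weight omega F (i0 : 'I_n) : rel_inv omega F -> F != 0 ->
  (`|denq omega|%N %| gcdn n 3)%N.
Proof.
move=> hF F0; have [P [Q [Q0 eF]]] := fracE F.
have P0 : P != 0 by apply: contraNneq F0 => P0; rewrite eF P0 tofrac0 mul0r.
pose W : {mpoly R[n * 4]} :=
  Xgen i0 kx * \prod_(i | i != i0) (Xgen i0 kx - Xgen i kx).
have hW x : peval W x = x i0 kx * \prod_(i | i != i0) (x i0 kx - x i kx).
  have hX i : evalat x (Xgen i kx) = x i kx by rewrite -[in RHS](map_Xgen x) [RHS]mxE.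
  rewrite pevalE rmorphM rmorph_prod /= hX; congr (_ * _).
  by apply: eq_bigr => i _; rewrite rmorphB /= !hX.
(* A point at which [F] is defined and nonzero, and such that [1 + t x_i0] has a
   root in [t] which is not a root of any other [1 + t x_i]. *)
have [x [[Px Qx] Wx]] : exists x, (peval P x != 0 /\ peval Q x != 0) /\ peval W x != 0.
  apply: generically_ex; apply: generically_and; first apply: generically_and.
  - by exists P.
  - by exists Q.
  apply: (@generically_neq0 _ _ _ (\matrix_(i, k) (i == i0)%:R)).
  rewrite hW mxE eqxx mul1r; apply/prodf_neq0 => i /negPf ii0.
  by rewrite mxE ii0 subr0 oner_neq0.
move: Wx; rewrite hW mulf_eq0 negb_or => /andP[x0 /prodf_neq0 xi].
rewrite dvdn_gcd; apply/andP; split.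
(* Here [J = t ^ n], which has order [n] at [0]. *)
- pose T : 'M[{poly R}]_3 := diag_mx (\row_r [:: 'X; 1; 1]`_r).
  have T1 : map_mx (horner_eval 1) T = 1%:M.
    by apply/matrixP => r c; elim/ord3_ind: r; elim/ord3_ind: c;
      rewrite !mxE /= /horner_eval !hornerE.
  have := weight_curve 0 hF eF Px Qx T1.
  have -> : \prod_i hden T (map_mx polyC x) i ^+ 3 = 1.
    by apply: big1 => i _; rewrite /hden linf_hpt !mxE /= !mul0r !add0r expr1n.
  rewrite det_diag !big_ord_recl big_ord0 !mxE /= !mulr1.
  rewrite -['X]subr0 -polyC0 mup_XsubCX eqxx.
  by rewrite mupNroot ?rootC ?oner_neq0 // subr0.
(* Here [J] is the inverse cube of the product of the [1 + t x_i], which has order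
   [-3] at [- 1 / x_i0]. *)
- pose T : 'M[{poly R}]_3 := 1%:M + 'X *: delta_mx thd3 fst3.
  have T1 : map_mx (horner_eval 0) T = 1%:M.
    by apply/matrixP => r c; elim/ord3_ind: r; elim/ord3_ind: c;
      rewrite !mxE /= /horner_eval !hornerE.
  have dT : \det T = 1.
    rewrite det_trig; last by apply/is_trig_mxP => r c;
      elim/ord3_ind: r; elim/ord3_ind: c => //= _; rewrite !mxE /= mulr0 addr0.
    by apply: big1 => r _; elim/ord3_ind: r; rewrite !mxE /= mulr0 addr0.
  have := weight_curve (- (x i0 kx)^-1) hF eF Px Qx T1.
  have hd i : hden T (map_mx polyC x) i = (x i kx)%:P * 'X + 1.
    by rewrite /hden linf_hpt !mxE /=; ring.
  rewrite dT expr1n mupNroot ?rootC ?oner_neq0 // sub0r dvdzE abszN.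
  rewrite (bigD1 i0) //= mulrC mupMr; last first.
    rewrite rootE horner_prod; apply/prodf_neq0 => i ii0.
    rewrite hd !hornerE expf_neq0 //.
    have := xi i ii0; apply: contraNneq => e.
    have -> : x i0 kx - x i kx = x i0 kx * (x i kx * - (x i0 kx)^-1 + 1) by field.
    by rewrite e mulr0.
  have -> : hden T (map_mx polyC x) i0 = (x i0 kx)%:P * ('X - (- (x i0 kx)^-1)%:P).
    rewrite hd polyCN opprK mulrDr -polyCM divff //.
  rewrite exprMn mupMr ?mup_XsubCX ?eqxx //.
  by rewrite -polyC_exp rootC expf_neq0.
Qed.

End Weights.

(** * The moving frame *)

Lemma det3 (A : comNzRingType) (M : 'M[A]_3) : \det M =
  M fst3 fst3 * (M snd3 snd3 * M thd3 thd3 - M snd3 thd3 * M thd3 snd3)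
  - M fst3 snd3 * (M snd3 fst3 * M thd3 thd3 - M snd3 thd3 * M thd3 fst3)
  + M fst3 thd3 * (M snd3 fst3 * M thd3 snd3 - M snd3 snd3 * M thd3 fst3).
Proof.
pose f i j := M (inord i) (inord j).
have fE r c : M r c = f (val r) (val c) by rewrite /f !inord_val.
rewrite (expand_det_row _ ord0) !big_ord_recl big_ord0 /cofactor.
rewrite !(expand_det_row _ ord0) !big_ord_recl !big_ord0 /cofactor !det_mx11.
by rewrite !mxE !fE /= /bump /=; ring.
Qed.

Section FrameForms.
Context {n : nat} (hn : (3 <= n)%N).
Local Notation P1 := (blk1 hn).
Local Notation P2 := (blk2 hn).
Local Notation P3 := (blk3 hn).

Lemma blk_split (A : comPzSemiRingType) (F : 'I_n -> A) :
  \prod_i F i = F P1 * F P2 * F P3 * \prod_(i < n | (3 <= i)%N) F i.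
Proof.
rewrite (bigD1 P1) //= (bigD1 P2) //= (bigD1 P3) //= !mulrA; congr (_ * _).
apply: eq_bigl => i; rewrite -!(inj_eq val_inj) /=.
by case: (val i) => [|[|[|k]]].
Qed.

Context {A : comNzRingType}.
Implicit Types (X : 'M[A]_(n, 4)) (i : 'I_n).

Definition delta123 X : A := pdelta X P1 P2 P3.
Definition Phi12 X : A := pPhi X P1 P1 P2.
Definition Phi13 X : A := pPhi X P1 P1 P3.
(** Up to the factor [delta123 / s_1], the denominator [s_i] of the frame. *)
Definition frame_form X i : A := pdelta X P2 P3 i + delta123 X * pPhi X P1 P1 i.

Lemma frame_form1 X : frame_form X P1 = delta123 X.
Proof. by rewrite /frame_form /delta123 /pdelta /pPhi; ring. Qed.

Lemma frame_form2 X : frame_form X P2 = delta123 X * Phi12 X.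
Proof. by rewrite /frame_form /delta123 /Phi12 /pdelta /pPhi; ring. Qed.

Lemma frame_form3 X : frame_form X P3 = delta123 X * Phi13 X.
Proof. by rewrite /frame_form /delta123 /Phi13 /pdelta /pPhi; ring. Qed.

Let m := (n %/ gcdn n 3)%N.
Let e := (3 %/ gcdn n 3)%N.

(** Numerator and denominator of [z'_n].  The sign makes their quotient the inverse
of [Jroot] of the frame, since [det T] is negative when [s_1], [delta123], [Phi12]
and [Phi13] are positive. *)
Definition znum X : A :=
  (-1) ^+ m * (delta123 X ^+ (3 * e) * \prod_(i < n | (3 <= i)%N) frame_form X i ^+ e).
Definition zden X : A := delta123 X ^+ (2 * m) * (Phi12 X * Phi13 X) ^+ (m - e).

End FrameForms.

Lemma map_znum (A B : comNzRingType) (f : {rmorphism A -> B}) n (hn : (3 <= n)%N)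
    (X : 'M[A]_(n, 4)) : f (znum hn X) = znum hn (map_mx f X).
Proof.
rewrite /znum !rmorphM !rmorphXn rmorphN rmorph1 /delta123 map_pdelta rmorph_prod.
congr (_ * (_ * _)); apply: eq_bigr => i _.
by rewrite rmorphXn /frame_form rmorphD rmorphM /delta123 !map_pdelta map_pPhi.
Qed.

Lemma map_zden (A B : comNzRingType) (f : {rmorphism A -> B}) n (hn : (3 <= n)%N)
    (X : 'M[A]_(n, 4)) : f (zden hn X) = zden hn (map_mx f X).
Proof.
by rewrite /zden rmorphM !rmorphXn rmorphM /delta123 /Phi12 /Phi13 map_pdelta !map_pPhi.
Qed.

Section Frames.
Context {R : realType} {n : nat} (hn : (3 <= n)%N).
Local Notation P1 := (blk1 hn).
Local Notation P2 := (blk2 hn).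
Local Notation P3 := (blk3 hn).
Implicit Types (x y : config R n) (T S : 'M[R]_3).

Definition is_frame T x := [/\ T \in unitmx, (forall i, sden T x i != 0)
  & cross_section hn (mxact T x)].

(** The locus where the frame exists; the values of the forms at the first three
blocks make [delta123], [Phi12] and [Phi13] nonzero there. *)
Definition regular x := forall i, frame_form hn x i != 0.

(** The invariance of [Phi] and [delta] up to the [s_i], with their values
[Phi12 = Phi13 = 1] and [delta123 = -1] on the cross-section, gives the first three
equations.  The last one expands the point of block [i] on the first three points:
the denominator is a linear form, whose values there are known up to the factor
[s_1]. *)
Lemma frame_sden T x : is_frame T x ->
  [/\ sden T x P2 = sden T x P1 * Phi12 hn x, sden T x P3 = sden T x P1 * Phi13 hn x,
      \det T * delta123 hn x = - (sden T x P1 * sden T x P2 * sden T x P3) &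
      forall i, delta123 hn x * sden T x i = sden T x P1 * frame_form hn x i].
Proof.
case=> uT nz [[x1 y1] [x2 y2] [x3 y3] [p1 q1]]; have h := act_related uT nz.
have e2 : sden T x P2 = sden T x P1 * Phi12 hn x.
  have := related_Phi P1 P2 h; rewrite {2}/pPhi x1 y1 x2 y2 p1 q1 => ->.
  by rewrite !subr0 !mulr1 mulr0 addr0 mulr1.
have e3 : sden T x P3 = sden T x P1 * Phi13 hn x.
  have := related_Phi P1 P3 h; rewrite {2}/pPhi x1 y1 x3 y3 p1 q1 => ->.
  by rewrite !subr0 !mulr1 mulr0 addr0 mulr1.
split=> // [|i].
  have := related_delta P1 P2 P3 h; rewrite {2}/pdelta x1 y1 x2 y2 x3 y3 => ->.
  by ring.
have : delta123 hn x * sden T x i = pdelta x i P2 P3 * sden T x P1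
    + pdelta x P1 i P3 * sden T x P2 + pdelta x P1 P2 i * sden T x P3.
  by rewrite /sden /linf /delta123 /pdelta; ring.
rewrite e2 e3 => ->; rewrite /frame_form /Phi12 /Phi13 /delta123 /pdelta /pPhi; ring.
Qed.

Lemma frame_regular T x : is_frame T x -> regular x.
Proof.
move=> fT; have [e2 e3 ed ei] := frame_sden fT; have [uT nz _] := fT.
have d0 : delta123 hn x != 0.
  have := nz P1; apply: contraNneq => d0; move/eqP: ed.
  by rewrite d0 mulr0 eq_sym oppr_eq0 !mulf_eq0 -!orbA !(negPf (nz _)).
move=> i; have := mulf_neq0 d0 (nz i); rewrite ei mulf_eq0 negb_or.
by case/andP.
Qed.

Lemma regular_neq0 x : regular x -> [/\ delta123 hn x != 0, Phi12 hn x != 0 & Phi13 hn x != 0].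
Proof.
move=> rx; have := rx P1; have := rx P2; have := rx P3; rewrite frame_form1 frame_form2 frame_form3.
by rewrite !mulf_eq0 !negb_or => /andP[_ ?] /andP[_ ?].
Qed.

Lemma zden_neq0 x : regular x -> zden hn x != 0.
Proof.
by case/regular_neq0 => d0 f2 f3; rewrite mulf_neq0 ?expf_neq0 ?mulf_neq0.
Qed.

(** The rows are the linear forms [v |-> delta(v, 2, 3)],
[v |-> Phi13 * delta(1, 2, v)] and [v |-> delta(v, 2, 3) + delta123 * Phi(v)], where
[Phi] is minus the contact line of the first block: the cross-section prescribes
the zeros of the first two forms at the first three points, and prescribes the
difference of the first and third form to be a multiple of the contact line.  The
scale is chosen so that [s_i] is [frame_form x i]. *)
Definition frame_mx x : 'M[R]_3 :=
  let a := \row_k [:: x P2 ky - x P3 ky; x P3 kx - x P2 kx;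
                      x P2 kx * x P3 ky - x P3 kx * x P2 ky]`_k in
  let b := Phi13 hn x *: \row_k [:: x P1 ky - x P2 ky; x P2 kx - x P1 kx;
                      x P1 kx * x P2 ky - x P2 kx * x P1 ky]`_k in
  \matrix_(r < 3) [:: a; b; a - delta123 hn x *: hcv x P1]`_r.

Lemma frame_mxE x k :
  (frame_mx x fst3 k = [:: x P2 ky - x P3 ky; x P3 kx - x P2 kx;
     x P2 kx * x P3 ky - x P3 kx * x P2 ky]`_k) *
  (frame_mx x snd3 k = Phi13 hn x * [:: x P1 ky - x P2 ky; x P2 kx - x P1 kx;
     x P1 kx * x P2 ky - x P2 kx * x P1 ky]`_k) *
  (frame_mx x thd3 k = [:: x P2 ky - x P3 ky; x P3 kx - x P2 kx;
     x P2 kx * x P3 ky - x P3 kx * x P2 ky]`_k - delta123 hn x * hcv x P1 0 k).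
Proof. by rewrite !mxE /= ?mxE. Qed.

Lemma frame_mx_sden x i : sden (frame_mx x) x i = frame_form hn x i.
Proof.
by rewrite /sden /linf !frame_mxE !hcvE /= /frame_form /delta123 /pdelta /pPhi; ring.
Qed.

Lemma det_frame_mx x : \det (frame_mx x) = - (delta123 hn x ^+ 2 * Phi12 hn x * Phi13 hn x).
Proof.
rewrite det3 !frame_mxE !hcvE /= /delta123 /Phi12 /Phi13 /pdelta /pPhi; ring.
Qed.

Lemma frame_mxP x : regular x -> is_frame (frame_mx x) x.
Proof.
move=> rx; have [d0 f2 f3] := regular_neq0 rx.
have uT : frame_mx x \in unitmx.
  by rewrite unitmxE unitfE det_frame_mx oppr_eq0 !mulf_neq0 ?expf_neq0.
have nz i : sden (frame_mx x) x i != 0 by rewrite frame_mx_sden.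
split=> //; have h := act_related uT nz.
have ptP i : (mxact (frame_mx x) x i kx = linf (frame_mx x) fst3 (x i kx) (x i ky) / frame_form hn x i)
    * (mxact (frame_mx x) x i ky = linf (frame_mx x) snd3 (x i kx) (x i ky) / frame_form hn x i).
  by rewrite -!frame_mx_sden !mxE.
have [_ _ hc] := h P1; rewrite frame_mx_sden frame_form1 in hc.
have hcv : hcv (mxact (frame_mx x) x) P1 = \row_k [:: 1; 0; -1]`_k.
  apply: (can_inj (mulmxK uT)); rewrite hc; apply/matrixP => r c.
  rewrite (ord1 r) [RHS]mxE sum3 !frame_mxE !mxE /=; ring.
have cp : mxact (frame_mx x) x P1 kp = 1 by rewrite -(hcvE _ _).1.1 hcv mxE.
have cq : mxact (frame_mx x) x P1 kq = 0 by rewrite -(hcvE _ _).1.2 hcv mxE.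
split; rewrite !(ptP, cp, cq) /linf ?frame_mxE ?frame_form1 ?frame_form2 ?frame_form3 //=.
all: split; (apply: (canLR (mulfK _)); first by rewrite ?mulf_neq0);
  rewrite /delta123 /Phi12 /Phi13 /pdelta /pPhi; ring.
Qed.

Lemma cross_section_hpt x y k : cross_section hn x -> cross_section hn y ->
  hpt x (tnth [tuple P1; P2; P3] k) = hpt y (tnth [tuple P1; P2; P3] k).
Proof.
move=> [[x1 y1] [x2 y2] [x3 y3] _] [[x1' y1'] [x2' y2'] [x3' y3'] _].
apply/matrixP => t z; rewrite {z}(ord1 z) !(tnth_nth P1).
elim/ord3_ind: k; elim/ord3_ind: t; rewrite !hptE //=.
- by rewrite x1 x1'.
- by rewrite y1 y1'.
- by rewrite x2 x2'.
- by rewrite y2 y2'.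
- by rewrite x3 x3'.
- by rewrite y3 y3'.
Qed.

(** Two frames send each of the first three points to multiples of the same vector,
and by frame_sden the ratio of these multiples is the same for the three points,
which span the space. *)
Lemma frame_unique T S x : is_frame T x -> is_frame S x ->
  exists2 c : R, c != 0 & S = c *: T.
Proof.
move=> fT fS; have [T2 T3 _ _] := frame_sden fT; have [S2 S3 _ _] := frame_sden fS.
have [d0 _ _] := regular_neq0 (frame_regular fT).
have [uT nT KT] := fT; have [uS nS KS] := fS.
pose c := sden S x P1 / sden T x P1.
have c0 : c != 0 by rewrite mulf_neq0 ?invr_eq0.
have c1 : sden S x P1 = c * sden T x P1 by rewrite /c divfK.
exists c => //; pose l k := tnth [tuple P1; P2; P3] k.
pose V : 'M[R]_3 := \matrix_(r, k) hpt x (l k) r 0.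
have uV : V \in unitmx.
  by rewrite unitmxE unitfE (pdelta_det (x := x) (i := P1) (j := P2) (k := P3)) // => r;
    rewrite mxE.
have es k : sden S x (l k) = c * sden T x (l k).
  by elim/ord3_ind: k; rewrite /l !(tnth_nth P1) /= ?S2 ?S3 ?T2 ?T3 c1 ?mulrA.
have ep k : hpt (mxact S x) (l k) = hpt (mxact T x) (l k) by exact: cross_section_hpt.
have epts k : S *m hpt x (l k) = c *: (T *m hpt x (l k)).
  have [_ -> _] := act_related uS nS (l k); have [_ -> _] := act_related uT nT (l k).
  by rewrite ep scalerA es.
apply: (can_inj (mulmxK uV)); apply/matrixP => r k.
have col (M : 'M[R]_3) : (M *m V) r k = (M *m hpt x (l k)) r 0.
  by rewrite mxE [RHS]mxE; apply: eq_bigr => t _; rewrite [V t k]mxE.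
by rewrite -scalemxAl [RHS]mxE !col epts mxE.
Qed.

Lemma frame_atE x g : frame_at hn x g <-> is_frame (val (repr g)) x.
Proof.
by split=> [[gx Kx]|[_ gx Kx]]; [split=> //; exact: valP | split].
Qed.

Lemma regular_rho_def x : regular x -> rho_def hn x.
Proof.
move=> /frame_mxP fx; have [uT nz Kx] := fx.
exists (\pi_(PGL3 R) (exist _ (frame_mx x) uT))%qT; split.
  by split; [exact/pact_def_pi | rewrite pact_pi].
move=> g /frame_atE fg; have [c c0 ec] := frame_unique fx fg.
rewrite -[g]reprK; apply/esym/eqP; rewrite eqmodE; apply/asboolP.
by exists c.
Qed.

Lemma rho_def_frame x : rho_def hn x -> is_frame (val (repr (rho hn x))) x.
Proof.
case=> g [gx _]; apply/frame_atE.
by apply: (@xgetPex _ _ (frame_at hn x)); exists g.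
Qed.

Let d := gcdn n 3.
Let m := (n %/ d)%N.
Let e := (3 %/ d)%N.

Let md : (m * d)%N = n. Proof. by rewrite /m divnK ?dvdn_gcdl. Qed.
Let ed : (e * d)%N = 3. Proof. by rewrite /e divnK ?dvdn_gcdr. Qed.
Let d0 : (0 < d)%N. Proof. by rewrite gcdn_gt0 orbT. Qed.
Let ne : (n * e = 3 * m)%N.
Proof.
have : (m * d * e = e * d * m)%N by rewrite mulnAC [(m * e)%N]mulnC mulnAC.
by rewrite md ed.
Qed.
Let em : (e <= m)%N. Proof. by rewrite -(leq_pmul2r d0) ed md. Qed.

(** The [d]-th root of the Jacobian multiplier as a rational function. *)
Definition Jroot T x : R := \det T ^+ m / \prod_i sden T x i ^+ e.

Lemma Jroot_neq0 T x : T \in unitmx -> (forall i, sden T x i != 0) -> Jroot T x != 0.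
Proof.
move=> uT nz; apply: mulf_neq0.
  by rewrite expf_neq0 // -unitfE -unitmxE.
by rewrite invr_eq0; apply/prodf_neq0 => i _; rewrite expf_neq0.
Qed.

Lemma mxJ_root T x : mxJ T x = Jroot T x ^+ d.
Proof.
rewrite /Jroot expr_div_n -exprM md -prodrXl; congr (_ / _).
by apply: eq_bigr => i _; rewrite -exprM ed.
Qed.

Definition zval x : R := znum hn x / zden hn x.

(** With [n * e = 3 * m] the powers of the free scale [s_1] cancel. *)
Lemma zval_frame T x : is_frame T x -> zval x = (Jroot T x)^-1.
Proof.
move=> fT; have [e2 e3 edet ei] := frame_sden fT; have [uT nz _] := fT.
have rx := frame_regular fT; have [l0 f2 f3] := regular_neq0 rx.
have nz1 := nz P1.
set s := sden T x P1 in e2 e3 edet ei nz1; set l := delta123 hn x in edet ei l0.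
set G := Phi12 hn x * Phi13 hn x; have G0 : G != 0 by rewrite mulf_neq0.
set Pi := \prod_(i < n | (3 <= i)%N) frame_form hn x i.
have Pi0 : Pi != 0 by apply/prodf_neq0 => i _; exact: rx.
have edT : \det T = - (s ^+ 3 * G / l).
  by apply: (mulIf l0); rewrite edet e2 e3 mulNr divfK // /G; ring.
have prod_s : l ^+ n * \prod_i sden T x i = s ^+ n * (G * l ^+ 3 * Pi).
  rewrite -[in l ^+ n](card_ord n) -[in s ^+ n](card_ord n) -!prodr_const -!big_split /=.
  under eq_bigr do rewrite ei.
  rewrite big_split /= prodr_const card_ord; congr (_ * _).
  by rewrite (blk_split hn) frame_form1 frame_form2 frame_form3 -/l -/Pi /G; ring.
have ln0 : l ^+ n != 0 by rewrite expf_neq0.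
have eprod : \prod_i sden T x i = s ^+ n * (G * l ^+ 3 * Pi) / l ^+ n.
  by rewrite -prod_s mulrC mulKf.
rewrite /Jroot prodrXl eprod edT /zval /znum /zden -/d -/m -/e -/l -/G prodrXl -/Pi.
clearbody G Pi s l; rewrite [(- (_ / _)) ^+ _]exprNn !expr_div_n -!exprM ne.
have pow (t : R) : t ^+ m = t ^+ e * t ^+ (m - e) by rewrite -exprD subnKC.
rewrite [(s ^+ n * _) ^+ _]exprMn [(_ * Pi) ^+ _]exprMn [(G * _) ^+ _]exprMn [(_ * G) ^+ _]exprMn -!exprM ne.
have hE : ((-1) ^+ m)^-1 = (-1) ^+ m :> R by rewrite -exprVn invrN1.
have E0 : (-1) ^+ m != 0 :> R by rewrite expf_neq0 // oppr_eq0 oner_eq0.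
rewrite -{1}hE; move: ((-1) ^+ m) E0 => eps E0 {hE}.
rewrite [(2 * m)%N]mulnC ![(3 * _)%N]mulnC !exprM !pow.
have Ae : l ^+ e != 0 by rewrite expf_neq0.
have Be : l ^+ (m - e) != 0 by rewrite expf_neq0.
have Ge : G ^+ e != 0 by rewrite expf_neq0.
have Gme : G ^+ (m - e) != 0 by rewrite expf_neq0.
have Se : s ^+ e != 0 by rewrite expf_neq0.
have Sme : s ^+ (m - e) != 0 by rewrite expf_neq0.
have Pe : Pi ^+ e != 0 by rewrite expf_neq0.
move: (l ^+ e) (l ^+ (m - e)) (G ^+ e) (G ^+ (m - e)) (s ^+ e) (s ^+ (m - e))
  (Pi ^+ e) Ae Be Ge Gme Se Sme Pe => A B G1 G2 s1 s2 P A0 B0 G10 G20 s10 s20 P0.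
by field; rewrite E0 A0 B0 G10 G20 s10 s20 P0.
Qed.

(** Equivariance of the frame and the cocycle rule for [Jroot]. *)
Lemma frame_act S T x : S \in unitmx -> (forall i, sden S x i != 0) ->
  is_frame T x ->
  is_frame (T *m invmx S) (mxact S x) /\
  Jroot (T *m invmx S) (mxact S x) = Jroot T x / Jroot S x.
Proof.
move=> uS nS [uT nT K].
have h := related_comp (related_inv uS (act_related uS nS)) (act_related uT nT).
have uTS : T *m invmx S \in unitmx by rewrite unitmx_mul uT unitmx_inv.
have es i : sden (T *m invmx S) (mxact S x) i = (sden S x i)^-1 * sden T x i.
  exact: related_sden h.
split.
  split; [exact: uTS | by move=> i; rewrite es mulf_neq0 ?invr_eq0 |].
  by rewrite -(related_act uTS h).
have -> : Jroot (T *m invmx S) (mxact S x) = (\det T / \det S) ^+ m *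
    (\prod_i sden S x i ^+ e / \prod_i sden T x i ^+ e).
  rewrite /Jroot det_mulmx det_inv; congr (_ * _); rewrite -invf_div; congr (_^-1).
  rewrite -prodf_div; apply: eq_bigr => i _.
  by rewrite es exprMn exprVn mulrC.
by rewrite expr_div_n /Jroot invf_div !mulf_div [X in _ = _ / X]mulrC.
Qed.

End Frames.

(** * The field of relative invariants *)

Section Main.
Context {R : realType} {n : nat} (hn : (3 <= n)%N).
Local Notation P1 := (blk1 hn).
Local Notation P2 := (blk2 hn).
Local Notation P3 := (blk3 hn).
Local Notation d := (gcdn n 3).
Implicit Types (x : config R n) (T S : 'M[R]_3) (F : ratfun R n).

Let odd_d : odd d. Proof. by apply: (dvdn_odd (dvdn_gcdr n 3)). Qed.

(** At a configuration on the cross-section the identity is a frame. *)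
Lemma generically_regular : generically (fun x : config R n => regular hn x).
Proof.
pose x : config R n := \matrix_(i, k)
  if i == P1 then [:: 1; 0; 1; 0]`_k else if i == P3 then [:: 0; 1; 0; 0]`_k else 0.
have [ex sx] := mxact1 x.
have rx : regular hn x.
  apply: (@frame_regular _ _ _ 1%:M); split; first exact: unitmx1.
    by move=> i; rewrite sx oner_neq0.
  rewrite ex; have e21 : (P2 == P1) = false by [].
  have e23 : (P2 == P3) = false by [].
  have e31 : (P3 == P1) = false by [].
  by split; rewrite !mxE ?eqxx ?e21 ?e23 ?e31 ?eqxx.
pose W : {mpoly R[n * 4]} := \prod_i frame_form hn Xgen i.
have eW y : peval W y = \prod_i frame_form hn y i.
  rewrite pevalE rmorph_prod; apply: eq_bigr => i _.
  by rewrite /frame_form rmorphD rmorphM /= /delta123 !map_pdelta map_pPhi map_Xgen.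
have Wx : peval W x != 0 by rewrite eW; apply/prodf_neq0 => i _; exact: rx.
apply: generically_imp (generically_neq0 Wx) => y; rewrite eW => /prodf_neq0 h i.
exact: h.
Qed.

Definition Zfrac : ratfun R n :=
  FracField.tofrac (znum hn Xgen) / FracField.tofrac (zden hn Xgen).

Lemma feval_Zfrac x : regular hn x -> feval Zfrac x (zval hn x).
Proof.
move=> rx; exists (znum hn Xgen), (zden hn Xgen).
have eN : peval (znum hn Xgen) x = znum hn x by rewrite pevalE map_znum map_Xgen.
have eD : peval (zden hn Xgen) x = zden hn x by rewrite pevalE map_zden map_Xgen.
by rewrite eN eD; split => //; exact: zden_neq0.
Qed.

Lemma zval_neq0 x : regular hn x -> zval hn x != 0.
Proof.
move=> /frame_mxP fx; rewrite (zval_frame fx) invr_eq0.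
by have [uT nz _] := fx; exact: Jroot_neq0.
Qed.

Lemma zval_act S x : S \in unitmx -> (forall i, sden S x i != 0) -> regular hn x ->
  regular hn (mxact S x) /\ zval hn (mxact S x) = Jroot S x * zval hn x.
Proof.
move=> uS nS /frame_mxP fx; have [fS eS] := frame_act uS nS fx.
split; first exact: frame_regular fS.
by rewrite (zval_frame fS) (zval_frame fx) eS invf_div.
Qed.

(** The weight [k / d] turns [J ^ omega] into the rational function [Jroot ^+ k].
Whatever fractions represent [F] at [x] and at its image, the equation to prove is,
after clearing denominators, an identity between polynomials in the configuration;
it is enough to know it at generic points. *)
Lemma rel_inv_generically F (k : nat) :
  (forall T, T \in unitmx -> generically (fun x => (forall i, sden T x i != 0) ->
     exists v, feval F x v /\ feval F (mxact T x) (Jroot T x ^+ k * v))) ->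
  rel_inv (k%:Z%:~R / d%:R) F.
Proof.
move=> hF g x v w gx _ [P [Q [eF Qx ->]]] [P' [Q' [eF' Q'x ->]]].
move: gx Q'x; rewrite /pact_def /pact /jac; set T := val (repr g) => gx Q'x.
have uT : T \in unitmx by exact: valP.
have f0 := Jroot_neq0 uT gx.
rewrite mxJ_root rpow_root // -exprnP.
have [u u0 [BP eBP [BQ eBQ]]] : exists2 u : config R n -> R,
    (forall y, (forall i, sden T y i != 0) -> u y != 0) &
    exists2 BP, (forall y, (forall i, sden T y i != 0) ->
      peval BP y = peval P' (mxact T y) * u y) &
    exists BQ, (forall y, (forall i, sden T y i != 0) ->
      peval BQ y = peval Q' (mxact T y) * u y).
  pose N := maxn (msize P') (msize Q').
  exists (fun y => peval (cden T) y ^+ N).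
    by move=> y ny; rewrite expf_neq0 //; apply/(cden_neq0 _ uT).
  exists (cpull T N P') => [y ny|]; first by apply: cpullE uT ny _; rewrite leq_maxl.
  by exists (cpull T N Q') => y ny; apply: cpullE uT ny _; rewrite leq_maxr.
have [CD [CS [eCD eCS]]] : exists CD CS : {mpoly R[n * 4]},
    [/\ forall y, peval CD y = \det T ^+ (n %/ d) &
        forall y, peval CS y = \prod_i sden T y i ^+ (3 %/ d)].
  exists ((\det T ^+ (n %/ d))%:MP),
    (\prod_i hden (map_mx (@mpolyC (n * 4) R) T) Xgen i ^+ (3 %/ d)).
  split=> y; first by rewrite /peval mevalC.
  rewrite pevalE rmorph_prod; apply: eq_bigr => i _.
  by rewrite rmorphXn /= map_hden map_mpolyC_mx map_Xgen -sden_hden.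
have eC y : Jroot T y = peval CD y / peval CS y by rewrite eCD eCS.
have CS0 y : (forall i, sden T y i != 0) -> peval CS y != 0.
  by move=> ny; rewrite eCS; apply/prodf_neq0 => i _; rewrite expf_neq0.
have BQx : peval BQ x != 0 by rewrite eBQ // mulf_neq0 // u0.
have poly : BP * Q * CS ^+ k = CD ^+ k * P * BQ.
  apply: peval_eq_generically.
  apply: generically_imp (generically_and (hF T uT) (generically_and
    (generically_sden uT) (generically_and (generically_neq0 Qx) (generically_neq0 BQx)))).
  move=> y [hy [ny [Qy BQy]]]; have {hy} [v' [hv hw]] := hy ny.
  have Q'y : peval Q' (mxact T y) != 0.
    by move: BQy; rewrite (eBQ y ny) mulf_eq0 negb_or => /andP[].
  have ev : v' = peval P y / peval Q y by apply: feval_uniq hv _; exists P, Q.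
  have ew : peval P' (mxact T y) / peval Q' (mxact T y) = Jroot T y ^+ k * v'.
    by symmetry; apply: feval_uniq hw _; exists P', Q'.
  rewrite !pevalM !pevalXn (eBP y ny) (eBQ y ny) (canRL (divfK Q'y) ew) ev eC.
  have := CS0 y ny; move: (peval CS y) (peval CD y) (peval P y) (peval Q y) Qy.
  move: (peval Q' _) (u y) => a b c c' p q q0 cn0.
  by rewrite expr_div_n; field; rewrite q0 expf_neq0.
have := congr1 (fun P : {mpoly R[n * 4]} => peval P x) poly.
rewrite /= !pevalM !pevalXn (eBP x gx) (eBQ x gx) eC.
have := CS0 x gx; have := u0 x gx.
move: (peval CS x) (peval CD x) (u x) (peval P x) (peval Q x) (peval P' _) (peval Q' _) Qx Q'x.
move=> c c' b p q p' q' q0 q'0 b0 c0 e.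
rewrite expr_div_n mulf_div; apply/eqP.
rewrite eqr_div ?mulf_neq0 ?expf_neq0 //; apply/eqP/(mulIf b0).
transitivity (p' * b * q * c ^+ k); first by ring.
by rewrite e; ring.
Qed.

Lemma rel_inv_Zfrac : rel_inv d%:R^-1 Zfrac.
Proof.
rewrite -div1r -[1]/(1%:Z%:~R); apply: rel_inv_generically => T uT.
apply: generically_imp generically_regular => x rx nx.
have [ry ey] := zval_act uT nx rx; exists (zval hn x); split; first exact: feval_Zfrac.
by rewrite expr1 -ey; apply: feval_Zfrac.
Qed.

Lemma abs_inv_rel_inv F : abs_inv F <-> rel_inv 0 F.
Proof.
split=> hF g x v w gx; first by move=> _ hv hw; rewrite rpow0 mul1r; apply: hF gx hv hw.
move=> hv hw; rewrite (hF g x v w gx _ hv hw) ?rpow0 ?mul1r //.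
rewrite /rpow_def /jac mxJ_root expf_neq0 ?orbT //.
by apply: Jroot_neq0 => //; exact: valP.
Qed.

(** The denominator of the weight is odd, so the real power in the hypothesis is
defined for all group elements, whatever the sign of the multiplier. *)
Lemma abs_inv_quotient F (k : int) :
  rel_inv (k%:~R / d%:R) F -> abs_inv (F * Zfrac ^ (- k)).
Proof.
move=> hF; apply/abs_inv_rel_inv; rewrite -[0](mul0r d%:R^-1).
apply: (rel_inv_generically (k := 0)) => T uT.
have [P [Q [Q0 eF]]] := fracE F.
have gQ : generically (fun x : config R n => peval Q x != 0) by exists Q.
apply: generically_imp (generically_and generically_regular
  (generically_and gQ (generically_act uT gQ))) => x [rx [Qx [_ Qy]]] nx.
have [ry ey] := zval_act uT nx rx.
have hv : feval F x (peval P x / peval Q x) by exists P, Q.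
have hw : feval F (mxact T x) (peval P (mxact T x) / peval Q (mxact T x)) by exists P, Q.
have c0 := Jroot_neq0 uT nx.
exists (peval P x / peval Q x * zval hn x ^ (- k)); split.
  by apply: fevalM hv (fevalXz _ (zval_neq0 rx) (feval_Zfrac rx)).
have def : rpow_def (mxJ T x) (k%:~R / d%:R) by rewrite mxJ_root rpow_def_root.
have := rel_inv_mx hF uT nx def hv hw; rewrite mxJ_root rpow_root // => ew.
have := fevalM hw (fevalXz (- k) (zval_neq0 ry) (feval_Zfrac ry)).
have weight0 (c a b : R) : c != 0 -> c ^ k * a * (c * b) ^ (- k) = a * b ^ (- k).
  by move=> c1; rewrite expfzMl mulrACA -expfzDr // subrr expr0z mul1r.
by rewrite expr0 mul1r ew ey weight0.
Qed.

Lemma rel_inv_integral_weight omega F : rel_inv omega F -> F != 0 ->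
  exists k : int, omega = k%:~R / d%:R.
Proof.
move=> hF F0; have /dvdnP[q eq] := rel_inv_weight P1 hF F0.
have q0 : q%:R != 0 :> rat.
  rewrite pnatr_eq0; apply: contraTneq (odd_d) => q0.
  by rewrite eq q0 mul0n.
exists (numq omega * q).
have -> : d%:R = q%:R * (denq omega)%:~R :> rat.
  by rewrite eq natrM -{2}(gez0_abs (ltW (denq_gt0 omega))).
rewrite -{1}(divq_num_den omega) intrM -[q%:Z%:~R]/(q%:R).
by field; rewrite intr_eq0 denq_neq0.
Qed.

Lemma zprimeE x : rho_def hn x -> zprime hn x = zval hn x.
Proof.
move=> /rho_def_frame fx; rewrite (zval_frame fx) /zprime /invJ /jac mxJ_root.
have [uT nz _] := fx.
have -> : - (d%:R)^-1 = (-1)%:~R / d%:R :> rat by rewrite mulN1r.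
by rewrite rpow_root // Jroot_neq0.
Qed.

(** The exponents agree since [d * m = n] and [d * e = 3]. *)
Lemma zval_formula x : regular hn x ->
  delta x P1 P2 P3 ^ (2 * n%:Z - 9) * (Phi x P1 P1 P2 * Phi x P1 P1 P3) ^+ (n - 3)
    * \prod_(i < n | (3 <= i)%N)
        (1 / (delta x P2 P3 i + delta x P1 P2 P3 * Phi x P1 P1 i) ^+ 3)
  = ((-1) ^+ (n %/ d) * zval hn x)^-1 ^+ d.
Proof.
move=> rx; have [l0 f2 f3] := regular_neq0 rx.
have md : (n %/ d * d)%N = n by rewrite divnK ?dvdn_gcdl.
have ed : (3 %/ d * d)%N = 3 by rewrite divnK ?dvdn_gcdr.
have -> : (-1) ^+ (n %/ d) * zval hn x =
    delta123 hn x ^+ (3 * (3 %/ d)) * \prod_(i < n | (3 <= i)%N) frame_form hn x i ^+ (3 %/ d) / zden hn x.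
  by rewrite /zval /znum mulrA mulrA -signr_odd -expr2 sqrr_sign mul1r.
have -> : (delta123 hn x ^+ (3 * (3 %/ d)) * \prod_(i < n | (3 <= i)%N) frame_form hn x i ^+ (3 %/ d)
      / zden hn x)^-1 ^+ d = delta123 hn x ^+ (2 * n) * (Phi12 hn x * Phi13 hn x) ^+ (n - 3)
    / (delta123 hn x ^+ 9 * \prod_(i < n | (3 <= i)%N) frame_form hn x i ^+ 3).
  rewrite invf_div expr_div_n /zden; congr (_ / _).
    rewrite [LHS]exprMn -(exprM (delta123 hn x)) -(exprM (Phi12 hn x * _)) -mulnA mulnBl.
    by rewrite md ed.
  rewrite [LHS]exprMn -exprM -mulnA ed -prodrXl; congr (_ * _).
  by apply: eq_bigr => i _; rewrite -exprM ed.
rewrite deltaE -/(delta123 hn x) expfzDr // -invr_expz.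
have -> : \prod_(i < n | (3 <= i)%N)
    (1 / (delta x P2 P3 i + delta123 hn x * Phi x P1 P1 i) ^+ 3)
  = (\prod_(i < n | (3 <= i)%N) frame_form hn x i ^+ 3)^-1.
  by rewrite -prodfV; apply: eq_bigr => i _; rewrite div1r deltaE.
have -> : delta123 hn x ^ (2 * n%:Z) = delta123 hn x ^+ (2 * n) by [].
have -> : delta123 hn x ^ 9 = delta123 hn x ^+ 9 by [].
by rewrite [in RHS]invfM [RHS]mulrACA mulrA.
Qed.

Lemma I_n_generated : @I_n R n = subfield_gen (@I_n0 R n `|` [set Zfrac]).
Proof.
have sub := @subfield_gen_subfield (ratfun R n).
apply/seteqP; split; last first.
  apply: smallest_sub; first exact: sub.
  move=> F [hF|->]; apply: sub_gen_smallest; first by exists 0; apply/abs_inv_rel_inv.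
  by exists d%:R^-1; exact: rel_inv_Zfrac.
pose L : set (ratfun R n) := subfield_gen (@I_n0 R n `|` [set Zfrac]).
have LM F G : L F -> L G -> L (F * G) by apply: subfieldM; exact: sub.
have LX F (k : int) : L F -> L (F ^ k) by apply: subfieldXz; exact: sub.
have LZ : L Zfrac by apply: sub_gen_smallest; right.
have L0 F : abs_inv F -> L F by move=> hF; apply: sub_gen_smallest; left.
apply: smallest_sub; first exact: sub.
move=> F [omega hF]; rewrite -/(L F).
have [->|F0] := eqVneq F 0; first by apply: subfield0; exact: sub.
have [k ek] := rel_inv_integral_weight hF F0; rewrite ek in hF.
have Z0 : Zfrac != 0.
  have [x rx] := generically_ex generically_regular.
  apply: contraNneq (zval_neq0 rx) => Z0.
  apply/eqP; apply: (feval_uniq (F := 0) (x := x)); first by rewrite -Z0; exact: feval_Zfrac.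
  by exists 0, 1; rewrite !pevalE !rmorph0 !rmorph1 !mul0r oner_neq0.
have -> : F = F * Zfrac ^ (- k) * Zfrac ^ k.
  by rewrite -mulrA -expfzDr // addNr expr0z mulr1.
by apply: (LM) (LX _ k LZ); apply: L0; apply: abs_inv_quotient.
Qed.

End Main.

Theorem mainTheorem3 (R : realType) (n : nat) (hn : (3 <= n)%N) :
  let d := gcdn n 3 in
  let P1 := blk1 hn in let P2 := blk2 hn in let P3 := blk3 hn in
  [/\ generically (fun x : config R n => rho_def hn x),
      exists s : bool, forall x : config R n, rho_def hn x ->
        zprime hn x = (-1) ^+ s *
          rpow (delta x P1 P2 P3 ^ (2 * n%:Z - 9)
                * (Phi x P1 P1 P2 * Phi x P1 P1 P3) ^+ (n - 3)
                * \prod_(i < n | (3 <= i)%N)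
                    (1 / (delta x P2 P3 i + delta x P1 P2 P3 * Phi x P1 P1 i) ^+ 3))
               (- d%:R^-1)
    & exists Z : ratfun R n,
        [/\ forall x : config R n, rho_def hn x -> feval Z x (zprime hn x),
            rel_inv d%:R^-1 Z
          & @I_n R n = subfield_gen (@I_n0 R n `|` [set Z])]].
Proof.
move=> d P1 P2 P3.
have reg x : rho_def hn x -> regular hn x.
  by move=> /rho_def_frame fx; exact: frame_regular fx.
have odd_d : odd d by apply: (dvdn_odd (dvdn_gcdr n 3)).
split.
- exact: generically_imp (@regular_rho_def R n hn) (generically_regular hn).
- exists (odd (n %/ d)) => x rx; rewrite zprimeE // zval_formula; last exact: reg.
  have -> : - (d%:R)^-1 = (-1)%:~R / d%:R :> rat by rewrite mulN1r.
  rewrite rpow_root //; last first.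
    rewrite invr_eq0; apply: mulf_neq0; last by apply: zval_neq0; exact: reg.
    by rewrite expf_neq0 // oppr_eq0 oner_eq0.
  by rewrite signr_odd -invr_expz expr1z invrK mulrA -expr2 sqrr_sign mul1r.
- exists (Zfrac hn); split=> [x rx||].
  + by rewrite zprimeE //; apply: feval_Zfrac; exact: reg.
  + exact: rel_inv_Zfrac.
  + exact: I_n_generated.
Qed.
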